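(* Let $\nu\vdash n$ with $\nu\neq(n)$ and $\nu_1\neq\nu_2$, put $\bar\nu=\nu+(n)$, and let $\lambda\vdash 2n$ with $\lambda_1=n+\nu_1-1$. Then $$\langle s_\nu\circ s_{(2)}\mid s_\lambda\rangle=\begin{cases}|I(\lambda)|=1&\text{if }\lambda=\bar\nu-\varepsilon_1-\varepsilon_x+\varepsilon_a+\varepsilon_b\text{ for some }x,a,b\geq 2\text{ with }x\neq a,b\text{ and with }\nu_a\neq\nu_b\text{ if }a\neq b,\\ |I(\lambda)|&\text{if }\lambda=\bar\nu-\varepsilon_1+\varepsilon_c\text{ for some }c>1,\\ 0&\text{otherwise.}\end{cases}$$
   Context: $s_\lambda$ is the Schur function of $\lambda$, $\langle\cdot\mid\cdot\rangle$ is the Hall inner product, and $\circ$ is plethysm ($s_\nu\circ s_{(2)}=s_\nu[s_{(2)}]$, with $p_k\circ g=g(x_1^k,x_2^k,\dots)$ and $f\mapsto f\circ g$ a ring homomorphism). Partitions are extended by zeros ($\nu_i=0$ for $i>\ell(\nu)$). $\bar\nu=\nu+(n)=(\nu_1+n,\nu_2,\nu_3,\dots)$. $\varepsilon_i$ is the $i$th unit vector, so adding/subtracting $\varepsilon_i$ adds/removes a box in row $i$. $M(\nu)$ is the set of partitions $\beta\vdash 2n$ obtained from $\bar\nu-\varepsilon_1$ by first removing a (removable) node in some row $x>1$ and then adding two nodes, in rows $a\geq b\geq 2$, where $\beta_a\neq\beta_b$ if $a\neq b$; so $\beta=\bar\nu-\varepsilon_1-\varepsilon_x+\varepsilon_a+\varepsilon_b$.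 For $\beta\in M(\nu)$, $I(\beta)$ is the set of all pairs $(a,b)$ with $a\geq b\geq 2$ for which $\beta$ can be obtained in this way (for some $x$, which is determined by $\beta$ and $(a,b)$); $I(\beta)=\emptyset$ if $\beta\notin M(\nu)$. *)

(* Defs.v *)
From HB Require Import structures.
From mathcomp Require Import all_boot all_order all_algebra.
From mathcomp Require Import freeg mpoly.
From Stdlib Require Import ClassicalEpsilon.

Set Implicit Arguments.
Unset Strict Implicit.
Unset Printing Implicit Defensive.

Import GRing.Theory.
Local Open Scope ring_scope.

(** * Partitions *)

Definition is_intpart (s : seq nat) : bool := sorted geq s && (0%N \notin s).

Record intpart := IntPart { parts :> seq nat; _ : is_intpart parts }.

HB.instance Definition _ := [isSub for parts].
HB.instance Definition _ := [Choice of intpart by <:].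

(** Rows are numbered from 1, and [part s i = 0] for [i] beyond the length;
    the index 0 is not a row. *)
Definition part (s : seq nat) (i : nat) : nat := nth 0%N (0%N :: s) i.

(** * Symmetric functions

    A symmetric function [f] in x_1, x_2, ... is given by its images
    [f N = f(x_1, ..., x_N, 0, 0, ...)], i.e. as an element of the inverse limit
    of the rings of symmetric polynomials.  The type below does not record that
    the components are symmetric, compatible with setting the last variable to
    zero and of bounded degree. *)
Definition symfun := forall N : nat, {mpoly rat[N]}.

(** Power sums and complete homogeneous functions, with p_mu and h_mu the
    products over the parts of mu. *)
Definition psum (k : nat) : symfun := fun N => \sum_(i < N) 'X_i ^+ k.

Definition hsum (k : nat) : symfun :=
  fun N => \sum_(m : 'X_{1..N < k.+1} | mdeg m == k) 'X_[m].

Definition psum_part (mu : intpart) : symfun :=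
  fun N => \prod_(k <- mu) psum k N.

Definition hsum_part (mu : intpart) : symfun :=
  fun N => \prod_(k <- mu) hsum k N.

(** Schur functions, as generating functions of semistandard tableaux: a cell is
    a pair (row, column), numbered from 0, and rows are weakly increasing while
    columns are strictly increasing. *)
Definition cell (la : seq nat) :=
  {c : 'I_(size la) * 'I_(head 0%N la) | (c.2 < nth 0%N la c.1)%N}.

Definition semistandard (la : seq nat) (N : nat)
    (T : {ffun cell la -> 'I_N}) : bool :=
  [forall c : cell la, forall d : cell la,
     (((val c).1 == (val d).1) && ((val c).2 <= (val d).2)%N
        ==> (T c <= T d)%N)
  && (((val c).2 == (val d).2) && ((val c).1 < (val d).1)%N
        ==> (T c < T d)%N)].

Definition schur (la : seq nat) : symfun :=
  fun N => \sum_(T : {ffun cell la -> 'I_N} | semistandard T)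
             \prod_(c : cell la) 'X_(T c).

(** [expands b f e]: f is the linear combination of the b_mu listed in e. *)
Definition expands (b : intpart -> symfun) (f : symfun)
    (e : seq (rat * intpart)) : Prop :=
  forall N : nat, f N = \sum_(t <- e) t.1 *: b t.2 N.

(** Since (p_mu) and (h_mu) are bases of the symmetric functions over the
    rationals, an expansion exists and is unique up to reordering and collecting
    terms, so that the two definitions below do not depend on the choice. *)
Definition expansion (b : intpart -> symfun) (f : symfun) :
    seq (rat * intpart) :=
  epsilon (inhabits [::]) (expands b f).

(** The coefficient of x_1^mu_1 x_2^mu_2 ... in g, that is the coefficient of
    the monomial symmetric function m_mu. *)
Definition mcoeff_part (mu : intpart) (g : symfun) : rat :=
  (g (size mu))@_[multinom nth 0%N mu i | i < size mu].

(** The Hall inner product: the bilinear form for which (h_mu) and (m_mu) are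
    dual bases. *)
Definition hall (f g : symfun) : rat :=
  \sum_(t <- expansion hsum_part f) t.1 * mcoeff_part t.2 g.

(** p_k o g = g(x_1^k, x_2^k, ...). *)
Definition psum_plethysm (k : nat) (g : symfun) : symfun :=
  fun N => g N \mPo [tuple 'X_i ^+ k | i < N].

(** f o g, extended from f = p_k so that f |-> f o g is a homomorphism of
    algebras over the rationals. *)
Definition plethysm (f g : symfun) : symfun :=
  fun N => \sum_(t <- expansion psum_part f)
             t.1 *: \prod_(k <- t.2) psum_plethysm k g N.

(** * Adding and removing boxes

    Partitions are compared inside the free abelian group on the rows 1, 2, ...;
    [eps i] is the i-th unit vector. *)
Definition eps (i : nat) : {freeg nat / int} := << i >>.

Definition rows (s : seq nat) : {freeg nat / int} :=
  \sum_(1 <= i < (size s).+1) eps i *+ part s i.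

(** nu + (n), where n is the size of nu. *)
Definition bar (nu : intpart) : {freeg nat / int} :=
  rows nu + eps 1 *+ sumn nu.

Definition removable (v : {freeg nat / int}) (x : nat) : bool :=
  coeff x.+1 v < coeff x v.

(** beta belongs to M(nu), by removing a node in row x and adding nodes in rows
    a and b. *)
Definition obtained (nu beta : intpart) (x a b : nat) : bool :=
  [&& (1 < x)%N, removable (bar nu - eps 1) x,
      (1 < b)%N, (b <= a)%N, (a != b) ==> (part beta a != part beta b)
    & rows beta == bar nu - eps 1 - eps x + eps a + eps b].

(** I(beta).  The bounds on the indices lose nothing: a removable row x > 1 is a
    row of nu, and the rows a, b that received a node are rows of beta. *)
Definition Iset (nu beta : intpart) :
    {set 'I_(size beta).+1 * 'I_(size beta).+1} :=
  [set ab : 'I_(size beta).+1 * 'I_(size beta).+1 |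
     [exists x : 'I_(size nu).+1, obtained nu beta x ab.1 ab.2]].

(* Main.v *)
Require Import Defs.
From HB Require Import structures.
From mathcomp Require Import all_boot all_order all_algebra.
From mathcomp Require Import freeg mpoly.
From mathcomp Require Import zify ring.
From Stdlib Require ClassicalEpsilon.

(** Write nu^- for nu without its first row, and expand the plethysm over an
    alphabet x, X. As h_2[x + X] = x^2 + x h_1[X] + h_2[X], branching gives

      s_nu[h_2[x + X]] = sum x^(2 |nu / mu| + |rho|) s_rho[X] s_(mu / rho)[h_2[X]]

    over horizontal strips nu / mu and over rho inside mu. The largest power of x
    is n + nu_1, with coefficient s_(nu^-), so that bar nu is the only constituent
    with a first row of that length. In the coefficient of x^(n + nu_1 - 1), the
    s_mu with |mu| = |nu^-| + 1 are cancelled by the contribution of bar nu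
    (because nu_1 > nu_2), which leaves the sum of h_2 s_rho over the rho obtained
    from nu^- by removing a box. By Pieri's rule the multiplicity of la is the
    number of such rho for which la^- / rho is a horizontal strip, and these rho
    correspond to the pairs in I(la).

    Pieri's rule is obtained by branching on the alphabet. It expands h_mu in Schur
    functions with Kostka coefficients, so the coefficients of a symmetric function
    in the Schur basis are its Hall products. *)

Set Implicit Arguments.
Unset Strict Implicit.
Unset Printing Implicit Defensive.

Import GRing.Theory.
Local Open Scope ring_scope.

(** * Horizontal strips *)

(** A multiplicity cannot be read off from a single coefficient: that of x^e s_rho[X] in the sum of
    the c_k s_k[x + X] adds up c_k over all k with k / rho a horizontal strip of size e. For rho =
    la^- and e = la_1, the shape la has the shortest first row among these k, so the c_k are found
    from the longest first row downwards. At length n + nu_1 - 1 the only longer k that survives is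
    bar nu, present when bar nu / la^- is a horizontal strip; nu_1 > nu_2 makes this equivalent to
    nu / la^- being one, and so produces the cancellation.

    Alphabets are lists over arbitrary commutative rings, so that [x] can be a polynomial
    indeterminate and the monomials of h_2 can be letters. Shapes are bounded by [d] to keep the
    sums over them finite. *)

Lemma sum_ord_recl n (F : nat -> nat) :
  (\sum_(i < n.+1) F i = F 0 + \sum_(i < n) F i.+1)%N.
Proof. by rewrite big_ord_recl. Qed.

Section Shapes.
Variable d : nat.

(** Row lengths of a partition of size at most [d]; since there are [d + 1] rows,
    the last one is empty. *)
Definition shape := 'X_{1..d.+1 < d.+1}.
Implicit Types a b c : shape.

Definition rowlen a (i : nat) : nat := nth 0%N (bmnm a : seq nat) i.

Lemma rowlenE a (i : 'I_d.+1) : (a : 'X_{1..d.+1}) i = rowlen a i.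
Proof. by rewrite (mnm_nth 0%N). Qed.

Lemma rowlen_ge a i : (d < i)%N -> rowlen a i = 0%N.
Proof. by move=> di; rewrite /rowlen nth_default // size_tuple. Qed.

Lemma mdeg_rowlen a : mdeg a = (\sum_(i < d.+1) rowlen a i)%N.
Proof. by rewrite mdegE; apply: eq_bigr => i _; rewrite rowlenE. Qed.

Lemma mdeg_shape a : (mdeg a <= d)%N.
Proof. by rewrite -ltnS bmdeg. Qed.

Lemma shapeP a b : (forall i, rowlen a i = rowlen b i) -> a = b.
Proof.
move=> ab; apply/val_inj/mnmP => i /=.
by rewrite !(mnm_nth 0%N) -/(rowlen a i) ab.
Qed.

(** If the rows add up to more than [d], the default is the empty shape; hence the bound on the sum
    in the lemmas that follow. *)
Definition mkshape (f : nat -> nat) : shape :=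
  insubd (@bm0 _ _) [multinom f i | i < d.+1].

Lemma rowlen_mk (f : nat -> nat) i :
  (\sum_(i < d.+1) f i <= d)%N -> (forall i, (d < i)%N -> f i = 0%N) ->
  rowlen (mkshape f) i = f i.
Proof.
move=> fd f0; case: (ltnP d i) => [di|]; first by rewrite rowlen_ge // f0.
rewrite -ltnS => id; rewrite -(rowlenE _ (Ordinal id)) /mkshape insubdK ?mnmE //.
by rewrite unfold_in mdegE (eq_bigr (fun i => f (nat_of_ord i))) // => j _; rewrite mnmE.
Qed.

Lemma mdeg_mk (f : nat -> nat) :
  (\sum_(i < d.+1) f i <= d)%N -> mdeg (mkshape f) = (\sum_(i < d.+1) f i)%N.
Proof.
move=> fd; have E: mdeg [multinom f i | i < d.+1] = (\sum_(i < d.+1) f i)%N.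
  by rewrite mdegE; apply: eq_bigr => j _; rewrite mnmE.
by rewrite /mkshape insubdK // unfold_in /= E.
Qed.

(** The interlacing forces both [a] and [b] to be partitions. *)
Definition hstrip a b :=
  [forall i : 'I_d.+1, (rowlen a i.+1 <= rowlen b i <= rowlen a i)%N].

Lemma hstripP a b :
  reflect (forall i, rowlen a i.+1 <= rowlen b i <= rowlen a i)%N (hstrip a b).
Proof.
apply: (iffP forallP) => [ab i|ab i]; last exact: ab.
case: (ltnP i d.+1) => [id|di]; first exact: (ab (Ordinal id)).
by rewrite !rowlen_ge // ltnW.
Qed.

Definition is_part a := hstrip a a.

Lemma is_partP a :
  reflect (forall i, rowlen a i.+1 <= rowlen a i)%N (is_part a).
Proof.
apply: (iffP (hstripP _ _)) => [aa i|aa i]; first by case/andP: (aa i).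
by rewrite aa leqnn.
Qed.

Lemma hstrip_partl a b : hstrip a b -> is_part a.
Proof.
move/hstripP=> ab; apply/is_partP => i.
by case/andP: (ab i) => ? ?; apply: leq_trans; eauto.
Qed.

Lemma hstrip_partr a b : hstrip a b -> is_part b.
Proof.
move/hstripP=> ab; apply/is_partP => i.
by case/andP: (ab i) (ab i.+1) => ? ? /andP[? ?]; apply: leq_trans; eauto.
Qed.

Lemma is_part_anti a i j : is_part a -> (i <= j)%N -> (rowlen a j <= rowlen a i)%N.
Proof.
move=> /is_partP pa; elim: j => [|j IH]; first by rewrite leqn0 => /eqP->.
rewrite leq_eqVlt => /predU1P[-> //|]; rewrite ltnS => /IH; exact: leq_trans.
Qed.

Lemma leq_mdeg a b : (forall i, rowlen b i <= rowlen a i)%N -> (mdeg b <= mdeg a)%N.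
Proof. by move=> ab; rewrite !mdeg_rowlen; apply: leq_sum. Qed.

Lemma hstrip_mdeg a b : hstrip a b -> (mdeg b <= mdeg a)%N.
Proof. by move/hstripP=> ab; apply: leq_mdeg => i; case/andP: (ab i). Qed.

Lemma eq_shape_mdeg a b :
  (forall i, rowlen b i <= rowlen a i)%N -> mdeg a = mdeg b -> a = b.
Proof.
move=> ab E; apply: shapeP => i; case: (ltnP d i) => [di|]; first by rewrite !rowlen_ge.
rewrite -ltnS => id; apply/eqP; rewrite eqn_leq ab andbT leqNgt; apply/negP => lt.
suff: (mdeg b < mdeg a)%N by rewrite E ltnn.
rewrite !mdeg_rowlen (bigD1 (Ordinal id)) //= [X in (_ < X)%N](bigD1 (Ordinal id)) //=.
by rewrite -addSn leq_add // leq_sum.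
Qed.

(** A box in the last row would put one in each of the [d + 1] rows. *)
Lemma rowlen_last a : is_part a -> rowlen a d = 0%N.
Proof.
move=> pa; apply/eqP; rewrite -leqn0 leqNgt; apply/negP => a0.
have := mdeg_shape a; rewrite mdeg_rowlen leqNgt => /negP; apply.
apply: (@leq_trans (\sum_(i < d.+1) 1)); first by rewrite sum1_card card_ord.
apply: leq_sum => i _; apply: leq_trans a0 _.
by apply: is_part_anti; rewrite -1?ltnS.
Qed.

Section LocalRule.
Variables (a b : shape) (k : nat).
Hypothesis (ak : (mdeg a + k <= d)%N).

Let mx i := maxn (rowlen a i) (rowlen b i).
Let mn i := minn (rowlen a i) (rowlen b i).

(** The first row of an upper bound exceeds [mx 0] by an amount with no counterpart in the rows of
    [c]. The total size [mdeg a + k] forces it to be |c| + k - |b|, hence the inequality imposed on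
    [c] in [local_rule]. *)
Let up c i :=
  if i is j.+1 then (mn j + mx i - rowlen c j)%N else (mx 0 + (mdeg c + k - mdeg b))%N.
Let down c i := (mn i + mx i.+1 - rowlen c i.+1)%N.

Let sum_mm : (\sum_(i < d.+1) mx i + \sum_(i < d.+1) mn i = mdeg a + mdeg b)%N.
Proof.
rewrite -big_split !mdeg_rowlen -big_split /=; apply: eq_bigr => i _.
by rewrite /mx /mn; lia.
Qed.

Let up_facts c : hstrip a c -> hstrip b c -> (mdeg b <= mdeg c + k)%N ->
  [/\ forall i, rowlen (mkshape (up c)) i = up c i,
      mdeg (mkshape (up c)) = (mdeg a + k)%N,
      hstrip (mkshape (up c)) a & hstrip (mkshape (up c)) b].
Proof.
move=> ac bc bk.
have [pa pb pc] := And3 (hstrip_partl ac) (hstrip_partl bc) (hstrip_partr ac).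
move/hstripP: (ac) => hac; move/hstripP: (bc) => hbc.
have sumE : (\sum_(i < d.+1) up c i = mdeg a + k)%N.
  rewrite sum_ord_recl /=.
  have: (\sum_(i < d) (mn i + mx i.+1 - rowlen c i) + mdeg c =
    \sum_(i < d.+1) mn i + \sum_(i < d) mx i.+1)%N.
    rewrite mdeg_rowlen !big_ord_recr /= (rowlen_last pc) /mn (rowlen_last pa) min0n !addn0.
    rewrite -!big_split /=; apply: eq_bigr => i _.
    by move: (hac i) (hbc i); rewrite /mx; lia.
  by have := sum_mm; rewrite [X in (X + _)%N]sum_ord_recl /=; have := mdeg_shape c; lia.
have z i : (d < i)%N -> up c i = 0%N.
  case: i => // i di; move: (hac i) (hbc i); rewrite /up /mn /mx.
  have: rowlen a i = 0%N.
    case: (leqP i d) => [id|/rowlen_ge //]; have -> : i = d by lia.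
    exact: rowlen_last.
  rewrite [rowlen a i.+1]rowlen_ge // [rowlen b i.+1]rowlen_ge //; lia.
have rE i : rowlen (mkshape (up c)) i = up c i by apply: rowlen_mk; rewrite ?sumE.
split=> //; first by rewrite mdeg_mk sumE.
  apply/hstripP => i; rewrite !rE; move: (hac i) (hbc i).
  by case: i => [|i]; [|move: (hac i) (hbc i)]; rewrite /= /mn /mx; lia.
apply/hstripP => i; rewrite !rE; move: (hac i) (hbc i).
by case: i => [|i]; [|move: (hac i) (hbc i)]; rewrite /= /mn /mx; lia.
Qed.

Let down_facts c : hstrip c a -> hstrip c b -> mdeg c = (mdeg a + k)%N ->
  [/\ forall i, rowlen (mkshape (down c)) i = down c i,
      (mdeg b + (rowlen c 0 - mx 0) = mdeg (mkshape (down c)) + k)%N,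
      hstrip a (mkshape (down c)) & hstrip b (mkshape (down c))].
Proof.
move=> ac bc ck.
have [pa pb pc] := And3 (hstrip_partr ac) (hstrip_partr bc) (hstrip_partl ac).
move/hstripP: (ac) => hac; move/hstripP: (bc) => hbc.
have sumE : (\sum_(i < d.+1) down c i + (mdeg a + k) =
             rowlen c 0 - mx 0 + (mdeg a + mdeg b))%N.
  have: (\sum_(i < d.+1) down c i + \sum_(i < d) rowlen c i.+1 =
         \sum_(i < d.+1) mn i + \sum_(i < d) mx i.+1)%N.
    rewrite !big_ord_recr /= /down /mn (rowlen_last pa) min0n.
    rewrite /mx [rowlen a d.+1]rowlen_ge // [rowlen b d.+1]rowlen_ge // maxn0 sub0n !addn0.
    rewrite -!big_split /=; apply: eq_bigr => i _.
    by move: (hac i) (hbc i) (hac i.+1) (hbc i.+1); lia.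
  have := sum_mm; rewrite [X in (X + _)%N]sum_ord_recl /=.
  have : (\sum_(i < d) rowlen c i.+1 + rowlen c 0 = mdeg c)%N.
    by rewrite mdeg_rowlen sum_ord_recl addnC.
  by move: (hac 0%N) (hbc 0%N); rewrite /mx /=; lia.
have le i : (down c i <= rowlen a i)%N /\ (down c i <= rowlen b i)%N.
  by move: (hac i) (hbc i) (hac i.+1) (hbc i.+1); rewrite /down /mn /mx; lia.
have sumd : (\sum_(i < d.+1) down c i <= d)%N.
  apply: leq_trans (mdeg_shape a); rewrite mdeg_rowlen; apply: leq_sum => i _.
  by case: (le i).
have rE i : rowlen (mkshape (down c)) i = down c i.
  by apply: rowlen_mk => // j dj; have [] := le j; rewrite rowlen_ge //; lia.
split=> //; first by rewrite mdeg_mk //; lia.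
  apply/hstripP => i; rewrite !rE /= /down /mn /mx.
  by move: (hac i) (hbc i) (hac i.+1) (hbc i.+1); lia.
apply/hstripP => i; rewrite !rE /= /down /mn /mx.
by move: (hac i) (hbc i) (hac i.+1) (hbc i.+1); lia.
Qed.

(* The rows of a common upper bound and those of a common lower bound range over
   the same intervals, except for the first row of the upper bound; reflecting
   each interval preserves the total size. *)
Lemma local_rule :
  #|[set c | [&& hstrip c a, hstrip c b & mdeg c == (mdeg a + k)%N]]| =
  #|[set c | [&& hstrip a c, hstrip b c & (mdeg b <= mdeg c + k)%N]]|.
Proof.
rewrite -!sum1_card.
rewrite (reindex_onto (fun c => mkshape (up c)) (fun c => mkshape (down c))) /=; last first.
  move=> c; rewrite inE => /and3P[ca cb /eqP ck].
  have [r1 m1 h1 h2] := down_facts ca cb ck.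
  have [|r2 m2 _ _] := up_facts h1 h2; first by rewrite -m1 leq_addr.
  apply: shapeP => i; rewrite r2.
  move/hstripP: ca => hac; move/hstripP: cb => hbc.
  case: i => [|i] /=.
    by move: m1 (hac 0%N) (hbc 0%N); rewrite /mx; lia.
  by rewrite r1 /down /mn /mx; move: (hac i) (hbc i) (hac i.+1) (hbc i.+1); lia.
apply: eq_bigl => c; rewrite !inE; apply/idP/idP.
  case/andP=> /and3P[ca cb /eqP ck] /eqP <-.
  by have [_ <- -> ->] := down_facts ca cb ck; rewrite leq_addr.
case/and3P=> ac bc bk; have [r1 m1 h1 h2] := up_facts ac bc bk.
rewrite h1 h2 m1 eqxx /=; apply/eqP.
have [r2 m2 _ _] := down_facts h1 h2 m1.
apply: shapeP => i; rewrite r2 /down r1 /= /mn /mx.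
by move/hstripP: ac => /(_ i); move/hstripP: bc => /(_ i); lia.
Qed.

End LocalRule.
End Shapes.

(** * Schur functions by branching, and Pieri's rule *)

Section Branching.
Variable d : nat.
Implicit Types a b c : shape d.

(** The first letter of the alphabet is the largest one: in a tableau of shape
    [a / b], it fills the outermost horizontal strip. *)
Fixpoint skew (R : comNzRingType) a b (xs : seq R) : R :=
  if xs is x :: ys then
    \sum_(c : shape d | hstrip a c) x ^+ (mdeg a - mdeg c) * skew c b ys
  else (a == b)%:R.

Definition sch (R : comNzRingType) a (xs : seq R) : R := skew a bm0 xs.

Fixpoint hcomp (R : comNzRingType) (xs : seq R) (k : nat) : R :=
  if xs is x :: ys then \sum_(j < k.+1) x ^+ j * hcomp ys (k - j)
  else (k == 0%N)%:R.

(** The head of [ms] is the size of the last horizontal strip added. *)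
Fixpoint kostka a (ms : seq nat) : nat :=
  if ms is m :: ns then
    \sum_(c : shape d | hstrip a c && (mdeg a == mdeg c + m)%N) kostka c ns
  else (a == bm0).

Lemma rowlen0 i : rowlen (bm0 : shape d) i = 0%N.
Proof.
case: (ltnP i d.+1) => [id|/rowlen_ge -> //].
by rewrite -(rowlenE _ (Ordinal id)) mnm0E.
Qed.

Lemma shape_mdeg_eq0 a : (mdeg a == 0%N) = (a == bm0).
Proof. by rewrite mdeg_eq0 -val_eqE. Qed.

Lemma is_part0 : is_part (bm0 : shape d).
Proof. by apply/is_partP => i; rewrite !rowlen0. Qed.

Section Ring.
Variable R : comNzRingType.
Implicit Types (x : R) (xs ys : seq R).

Lemma skew_cons a b x xs :
  skew a b (x :: xs) =
  \sum_(c : shape d | hstrip a c) x ^+ (mdeg a - mdeg c) * skew c b xs.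
Proof. by []. Qed.

Lemma skew_cat a b xs ys :
  skew a b (xs ++ ys) = \sum_c skew a c xs * skew c b ys.
Proof.
elim: xs a => [|x xs IH] a.
  rewrite (bigD1 a) //= eqxx mul1r big1 ?addr0 // => c.
  by rewrite eq_sym => /negbTE->; rewrite mul0r.
rewrite cat_cons skew_cons; under eq_bigr => c _ do rewrite IH mulr_sumr.
rewrite exchange_big; apply: eq_bigr => c _; rewrite skew_cons mulr_suml.
by apply: eq_bigr => e _; rewrite mulrA.
Qed.

Lemma skew_lt a b xs : (mdeg a < mdeg b)%N -> skew a b xs = 0.
Proof.
elim: xs a => [|x xs IH] a /= ab.
  by case: eqP ab => // ->; rewrite ltnn.
by apply: big1 => c /hstrip_mdeg ac; rewrite IH ?mulr0 //; apply: leq_ltn_trans ab.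
Qed.

(** No strip can be removed from a shape that is not a partition, so its [skew a a] vanishes on a
    nonempty alphabet. *)
Lemma skew_eq_mdeg a b xs :
  is_part a -> mdeg a = mdeg b -> skew a b xs = (a == b)%:R.
Proof.
move=> pa ab; elim: xs => [//|x xs IH] /=.
rewrite (bigD1 a) //= subnn expr0 mul1r IH big1 ?addr0 // => c /andP[ac ca].
rewrite skew_lt ?mulr0 // -ab ltn_neqAle (hstrip_mdeg ac) andbT.
apply: contra ca => /eqP E; apply/eqP/esym/eq_shape_mdeg => // i.
by move/hstripP: ac => /(_ i)/andP[].
Qed.

(** A single box may receive any letter, and for one box [hstrip a b] just says that [b] is a
    partition inside [a]. When the letters are the monomials of h_2, their sum is h_2. *)
Lemma skew_mdegS a b xs :
  is_part a -> mdeg a = (mdeg b).+1 ->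
  skew a b xs = (hstrip a b)%:R * \sum_(x <- xs) x.
Proof.
move=> pa ab; elim: xs => [|x xs IH] /=.
  by rewrite big_nil mulr0; case: eqP ab => // -> /n_Sn.
rewrite big_cons mulrDr -IH (bigD1 a) //= subnn expr0 mul1r addrC; congr (_ + _).
have [hab|hab] := boolP (hstrip a b).
  rewrite mul1r (bigD1 b) /=; last first.
    by rewrite hab; apply/eqP => E; move: ab; rewrite E => /n_Sn.
  rewrite ab subSn // subnn expr1 skew_eq_mdeg ?eqxx ?mulr1 ?(hstrip_partr hab) //.
  rewrite big1 ?addr0 // => c /andP[/andP[ac ca] cb].
  case: (ltngtP (mdeg c) (mdeg b)) => [lt|gt|E]; first by rewrite skew_lt // mulr0.
    case/negP: ca; apply/eqP/esym/eq_shape_mdeg.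
      by move=> i; move/hstripP: ac => /(_ i)/andP[].
    by apply/eqP; rewrite eqn_leq (hstrip_mdeg ac) ab gt.
  by rewrite skew_eq_mdeg ?(negbTE cb) ?mulr0 // (hstrip_partr ac).
rewrite mul0r big1 // => c /andP[ac ca].
case: (ltngtP (mdeg c) (mdeg b)) => [lt|gt|E]; first by rewrite skew_lt // mulr0.
  case/negP: ca; apply/eqP/esym/eq_shape_mdeg.
    by move=> i; move/hstripP: ac => /(_ i)/andP[].
  by apply/eqP; rewrite eqn_leq (hstrip_mdeg ac) ab gt.
rewrite skew_eq_mdeg ?(hstrip_partr ac) //; case: eqP => [E'|]; last by rewrite mulr0.
by move: hab; rewrite -E' ac.
Qed.

(** Once the letter [x] is split off, both sides are sums over the shape [e] left to [xs], with an
    exponent of [x] that depends on [e] alone. The multiplicities count common lower bounds of [a]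
    and [e] on the left and common upper bounds on the right, so [local_rule] equates them. *)
Lemma pieri a k xs : (mdeg a + k <= d)%N ->
  hcomp xs k * sch a xs =
  \sum_(c : shape d | hstrip c a && (mdeg c == mdeg a + k)%N) sch c xs.
Proof.
elim: xs a k => [|x xs IH] a k ak.
  rewrite /sch /=; have [->|a0] := eqVneq a bm0.
    rewrite mulr1; have [->|k0] := eqVneq k 0%N.
      rewrite (bigD1 bm0) /=; last by rewrite addn0 eqxx andbT; exact: is_part0.
      by rewrite eqxx big1 ?addr0 // => c /andP[_ /negbTE ->].
    rewrite big1 // => c /andP[_]; case: (c =P bm0) => // -> /eqP E.
    by case/eqP: k0; apply/eqP; rewrite -(eqn_add2l (mdeg (bm0 : shape d))) -E addn0.
  rewrite mulr0 big1 // => c /andP[ca /eqP ck]; case: (c =P bm0) => // c0.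
  case/negP: a0; rewrite -shape_mdeg_eq0 -leqn0; move: (hstrip_mdeg ca).
  by rewrite c0 mdeg0.
pose P c e := [&& hstrip a c, hstrip e c & (mdeg e <= mdeg c + k)%N].
pose Q c e := [&& hstrip c a, hstrip c e & (mdeg c == mdeg a + k)%N].
transitivity (\sum_e \sum_(c | P c e) x ^+ (mdeg a + k - mdeg e) * sch e xs).
  rewrite {1}/sch /= mulr_sumr.
  transitivity (\sum_(c | hstrip a c) \sum_(e | hstrip e c && (mdeg e <= mdeg c + k)%N)
                  x ^+ (mdeg a + k - mdeg e) * sch e xs); last first.
    by rewrite (exchange_big_dep xpredT).
  apply: eq_bigr => c ac; have ca := hstrip_mdeg ac.
  transitivity (\sum_(j < k.+1) \sum_(e | hstrip e c && (mdeg e == mdeg c + (k - j))%N)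
                  x ^+ (mdeg a + k - mdeg e) * sch e xs).
    rewrite mulr_suml; apply: eq_bigr => j _; have jk : (j <= k)%N by rewrite -ltnS.
    rewrite -/(sch c xs) mulrCA -!mulrA IH; last first.
      by apply: leq_trans ak; rewrite leq_add // leq_subr.
    rewrite mulrA -exprD mulr_sumr; apply: eq_bigr => e /andP[_ /eqP ->].
    by congr (x ^+ _ * _); lia.
  (* The size of [e] determines [j]; the sum over [j] turns into a bound on that size. *)
  rewrite (exchange_big_dep (fun e => hstrip e c && (mdeg e <= mdeg c + k)%N)) /=; last first.
    by move=> j e _ /andP[-> /eqP ->] /=; rewrite leq_add2l leq_subr.
  apply: eq_bigr => e /andP[ec ek]; have ce := hstrip_mdeg ec.
  have jk : (mdeg c + k - mdeg e < k.+1)%N by lia.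
  rewrite (big_pred1 (Ordinal jk)) // => j; rewrite ec /= -val_eqE /=.
  by have := ltn_ord j; lia.
transitivity (\sum_e \sum_(c | Q c e) x ^+ (mdeg a + k - mdeg e) * sch e xs).
  apply: eq_bigr => e _; rewrite !sumr_const; congr (_ *+ _).
  have := local_rule e ak; rewrite !cardsE => E.
  by rewrite -[LHS]E.
symmetry; rewrite /sch /= (exchange_big_dep xpredT) //=; apply: eq_bigr => e _.
apply: eq_big => [c|c /andP[/andP[_ /eqP ->] _] //].
by rewrite /Q -andbA; congr (_ && _); exact: andbC.
Qed.

Lemma kostka_mdeg a ms : kostka a ms != 0%N -> mdeg a = sumn ms.
Proof.
elim: ms a => [|m ms IH] a /=.
  by have [->|] := eqVneq a bm0; rewrite ?mdeg0.
rewrite sum_nat_eq0 negb_forall => /existsP[c]; rewrite negb_imply.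
by case/andP=> /andP[_ /eqP ->] /IH ->; rewrite addnC.
Qed.

Lemma prod_hcomp ms xs : (sumn ms <= d)%N ->
  \prod_(m <- ms) hcomp xs m = \sum_a (kostka a ms)%:R * sch a xs.
Proof.
elim: ms => [|m ms IH] /= md.
  rewrite big_nil (bigD1 bm0) //= eqxx mul1r big1 ?addr0.
    by rewrite /sch skew_eq_mdeg ?eqxx // is_part0.
  by move=> a /negbTE->; rewrite mul0r.
rewrite big_cons IH; last by apply: leq_trans md; rewrite leq_addl.
rewrite mulr_sumr.
transitivity (\sum_(c : shape d)
   \sum_(a : shape d | hstrip a c && (mdeg a == mdeg c + m)%N) (kostka c ms)%:R * sch a xs).
  apply: eq_bigr => c _; have [->|/kostka_mdeg cm] := eqVneq (kostka c ms) 0%N.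
    by rewrite mul0r mulr0 big1 // => ? _; rewrite mul0r.
  by rewrite mulrCA pieri ?mulr_sumr // cm addnC.
rewrite (exchange_big_dep xpredT) //=; apply: eq_bigr => a _.
by rewrite natr_sum mulr_suml.
Qed.

End Ring.

Lemma rmorph_skew (R S : comNzRingType) (f : {rmorphism R -> S}) a b (xs : seq R) :
  f (skew a b xs) = skew a b (map f xs).
Proof.
elim: xs a => [|x xs IH] a /=; first by rewrite rmorph_nat.
by rewrite rmorph_sum; apply: eq_bigr => c _; rewrite rmorphM rmorphXn IH.
Qed.

End Branching.

(** * Kostka numbers *)

Section Triangularity.
Variable d : nat.
Implicit Types a b c : shape d.

(** The statistic n(lambda), the sum of (i - 1) lambda_i. It strictly decreases when the shape goes
    up in dominance order, and replaces that order in the triangularity of the Kostka matrix. *)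
Definition rowwt a := (\sum_(i < d.+1) i * rowlen a i)%N.

(** The same statistic for a content listed from its last letter, the order in which [kostka] peels
    off strips. *)
Fixpoint seqwt (ms : seq nat) : nat :=
  if ms is m :: ns then (size ns * m + seqwt ns)%N else 0%N.

Lemma seqwt_rev (s : seq nat) : seqwt (rev s) = (\sum_(i < size s) i * nth 0 s i)%N.
Proof.
elim/last_ind: s => [|s x IH]; first by rewrite big_ord0.
rewrite rev_rcons /= size_rev IH size_rcons big_ord_recr /= nth_rcons ltnn eqxx.
by rewrite addnC; congr (_ + _)%N; apply: eq_bigr => i _; rewrite nth_rcons ltn_ord.
Qed.

Lemma seqwt_shape a : seqwt (rev (a : 'X_{1..d.+1})) = rowwt a.
Proof. by rewrite seqwt_rev size_tuple. Qed.

(** Each strip opens at most one new row, so a strip that follows s others lies in rows 0 to s and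
    its boxes weigh at most s each. Equality of the weights puts the whole strip in row s. *)
Lemma kostka_tri a ms : kostka a ms != 0%N ->
  [/\ forall i, (size ms <= i)%N -> rowlen a i = 0%N,
      (rowwt a <= seqwt ms)%N &
      rowwt a = seqwt ms -> forall i, rowlen a i = nth 0%N (rev ms) i].
Proof.
elim: ms a => [|m ms IH] a.
  rewrite /=; have [->|//] := eqVneq a bm0 => _.
  have w0 : rowwt (bm0 : shape d) = 0%N.
    by rewrite /rowwt big1 // => i _; rewrite rowlen0 muln0.
  by split=> [i _||_ i]; rewrite ?w0 ?rowlen0 // nth_nil.
rewrite [kostka _ _]/= sum_nat_eq0 negb_forall => /existsP[c]; rewrite negb_imply.
case/andP=> /andP[ac /eqP am] /IH[c0 cw ceq] {IH}.
move/hstripP: ac => ac; set s := size ms.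
have a0 i : (s < i)%N -> rowlen a i = 0%N.
  by case: i => // i si; have := ac i; rewrite c0 //; lia.
pose e i := (rowlen a i - rowlen c i)%N.
have aE i : rowlen a i = (rowlen c i + e i)%N by have := ac i; rewrite /e; lia.
have em : (\sum_(i < d.+1) e i = m)%N.
  apply/eqP; rewrite -(eqn_add2l (mdeg c)) -am !mdeg_rowlen -big_split /=.
  by apply/eqP/eq_bigr => i _; rewrite -aE.
(* The second sum is the weight lost by boxes above row [s]. Truncation of [s - i] is harmless, as
   no box is added beyond row [s]. *)
have ew : (\sum_(i < d.+1) i * e i + \sum_(i < d.+1) (s - i) * e i = s * m)%N.
  rewrite -em -big_split big_distrr /=; apply: eq_bigr => i _; rewrite -mulnDl.
  case: (leqP i s) => [is_|si]; first by rewrite subnKC.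
  by rewrite /e a0 // sub0n !muln0.
have wE : rowwt a = (rowwt c + \sum_(i < d.+1) i * e i)%N.
  by rewrite /rowwt -big_split /=; apply: eq_bigr => i _; rewrite aE mulnDr.
split=> //=; rewrite ?wE; first by lia.
move=> eqw i; have {}ceq := ceq ltac:(lia).
have /eqP : (\sum_(i < d.+1) (s - i) * e i = 0)%N by lia.
rewrite sum_nat_eq0 => /forallP e0.
have {}e0 j : j != s -> e j = 0%N.
  case: (ltnP j d.+1) => [jd|jd _]; last by rewrite /e !rowlen_ge.
  case: (ltngtP j s) => // js _; last by rewrite /e a0.
  by have := e0 (Ordinal jd); rewrite /= muln_eq0 subn_eq0 leqNgt js /= => /eqP.
rewrite rev_cons nth_rcons size_rev -/s; case: ltngtP => [lt|gt|->].
- by rewrite aE e0 ?addn0 ?ceq // neq_ltn lt.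
- by rewrite a0.
rewrite aE c0 // add0n.
case: (ltnP s d.+1) => [sd|ds]; last first.
  by rewrite /e rowlen_ge // -em big1 // => j _; rewrite e0 // neq_ltn (leq_trans (ltn_ord j)).
rewrite -em (bigD1 (Ordinal sd)) //= big1 ?addn0 // => j.
by rewrite -val_eqE /= => /e0.
Qed.

(** The shape before the last strip has too few rows to meet the last row of [a], so the strip is
    exactly that row: there is one choice at every step. *)
Lemma kostka_diag a ms :
  is_part a -> (forall i, rowlen a i = nth 0%N (rev ms) i) -> kostka a ms = 1%N.
Proof.
elim: ms a => [|m ms IH] a pa ams /=.
  suff -> : a = bm0 by rewrite eqxx.
  by apply: shapeP => i; rewrite ams rowlen0 nth_nil.
set s := size ms.
have aE i : rowlen a i = if (i < s)%N then nth 0%N (rev ms) i else if i == s then m else 0%N.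
  by rewrite ams rev_cons nth_rcons size_rev.
pose f i := if (i < s)%N then rowlen a i else 0%N.
have fa i : (f i <= rowlen a i)%N by rewrite /f; case: ifP.
pose c0 : shape d := mkshape d f.
have fd : (\sum_(i < d.+1) f i <= d)%N.
  by apply: leq_trans (mdeg_shape a); rewrite mdeg_rowlen; apply: leq_sum.
have c0E i : rowlen c0 i = f i.
  by apply: rowlen_mk => // j dj; have := fa j; rewrite rowlen_ge // leqn0 => /eqP.
have ac0 : hstrip a c0.
  apply/hstripP => i; rewrite c0E fa andbT /f; case: ifP => [_|/negbT].
    by move/is_partP: pa; apply.
  by rewrite -leqNgt aE => si; rewrite !ifF //; lia.
have am : mdeg a = (mdeg c0 + m)%N.
  rewrite mdeg_mk // mdeg_rowlen.
  case: (ltnP s d.+1) => [sd|ds].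
    rewrite (bigD1 (Ordinal sd)) //= [in RHS](bigD1 (Ordinal sd)) //= aE /f ltnn eqxx add0n.
    rewrite addnC; congr (_ + _)%N; apply: eq_bigr => j; rewrite -val_eqE /= => js.
    by case: ifP => // js'; rewrite aE js' (negbTE js).
  have -> : m = 0%N by have := aE s; rewrite ltnn eqxx rowlen_ge.
  by rewrite addn0; apply: eq_bigr => j _; rewrite /f (leq_trans (ltn_ord j)).
rewrite (bigD1 c0) /=; last by rewrite ac0 am eqxx.
rewrite IH ?(hstrip_partr ac0) //; last first.
  move=> i; rewrite c0E /f aE; case: (ltnP i s) => // si.
  by rewrite nth_default // size_rev.
rewrite big1 // => c /andP[/andP[ac /eqP cm] cc0].
apply/eqP; apply: contraR cc0 => /kostka_tri[c0' _ _]; apply/eqP/esym/eq_shape_mdeg.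
  move=> i; rewrite c0E /f; case: ifP => [_|/negbT]; first by move/hstripP: ac => /(_ i)/andP[].
  by rewrite -leqNgt => /c0' ->.
by apply/eqP; rewrite -(eqn_add2r m) -am cm.
Qed.

Lemma kostka_shape a : is_part a -> kostka a (rev (a : 'X_{1..d.+1})) = 1%N.
Proof. by move=> pa; apply: kostka_diag => // i; rewrite revK. Qed.

Lemma kostka_shape_lt a b : kostka a (rev (b : 'X_{1..d.+1})) != 0%N ->
  a != b -> (rowwt a < rowwt b)%N.
Proof.
move=> /kostka_tri[_]; rewrite seqwt_shape leq_eqVlt => /predU1P[-> /(_ erefl)|//].
by rewrite revK => E /eqP[]; apply: shapeP.
Qed.

Lemma kostka_is_part a ms : kostka a ms != 0%N -> is_part a.
Proof.
case: ms => [|m ms] /=; first by have [->|//] := eqVneq a bm0; rewrite is_part0.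
rewrite sum_nat_eq0 negb_forall => /existsP[c]; rewrite negb_imply.
by case/andP=> /andP[/hstrip_partl].
Qed.

End Triangularity.

(** * Monomial coefficients of Schur functions *)

Section Coefficients.
Variables (R : comNzRingType) (N : nat).

Lemma mcoeffXnM (i : 'I_N) e (p : {mpoly R[N]}) m :
  ('X_i ^+ e * p)@_m = if (e <= m i)%N then p@_(m - U_(i) *+ e) else 0.
Proof.
rewrite mpolyXn mulrC; case: leqP => em.
  rewrite -{1}(submK (m := (U_(i) *+ e)%MM) (m' := m)).
    by rewrite addmC mcoeffMX.
  apply/mnm_lepP => j; rewrite mulmnE mnm1E; case: eqP => [<-|]; last by rewrite mul0n.
  by rewrite mul1n.
apply: memN_msupp_eq0; rewrite (perm_mem (msuppMX _ _)).
apply/negP => /mapP[m' _ E]; move: em; rewrite E mnmDE mulmnE mnm1E eqxx mul1n.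
by rewrite ltnNge leq_addr.
Qed.

(** As [s] has no repetition, the exponent in [m] of its first letter is the size of the strip
    filled with that letter. *)
Lemma mcoeff_sch d (a : shape d) (s : seq 'I_N) m : uniq s ->
  (sch a [seq ('X_i : {mpoly R[N]}) | i <- s])@_m =
  if [forall j, (j \notin s) ==> (m j == 0%N)]
  then (kostka a [seq m i | i <- s])%:R else 0.
Proof.
elim: s a m => [|i s IH] a m /=.
  move=> _; rewrite /sch /= -mpolyC_nat mcoeffC.
  suff -> : [forall j, (j \notin [::]) ==> (m j == 0%N)] = (m == 0%MM).
    by case: ifP; rewrite ?mulr1 ?mulr0.
  apply/forallP/eqP => [m0|-> j]; last by rewrite mnm0E.
  by apply/mnmP => j; rewrite mnm0E; apply/eqP/m0.
case/andP=> ins us; rewrite /sch skew_cons raddf_sum /=.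
under eq_bigr => c _ do rewrite mcoeffXnM.
pose m' e := (m - U_(i) *+ e)%MM.
have m'E e j : m' e j = (m j - (i == j) * e)%N.
  by rewrite /m' mnmBE mulmnE mnm1E.
have map_m' e : [seq m' e j | j <- s] = [seq m j | j <- s].
  apply/eq_in_map => j js; rewrite m'E; case: eqP => [E|_]; last by rewrite mul0n subn0.
  by move: ins; rewrite E js.
have supp_m' e : (e <= m i)%N ->
    [forall j, (j \notin s) ==> (m' e j == 0%N)] =
    [forall j, (j \notin i :: s) ==> (m j == 0%N)] && (e == m i).
  move=> em; apply/forallP/andP => [H|[/forallP H /eqP ee] j].
    split; last first.
      by have := H i; rewrite ins m'E eqxx mul1n /= subn_eq0 eqn_leq em.
    apply/forallP => j; rewrite inE negb_or; apply/implyP => /andP[ji js].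
    by have := H j; rewrite js m'E [i == j]eq_sym (negbTE ji) mul0n subn0.
  apply/implyP => js; rewrite m'E; have := H j; rewrite inE (negbTE js) orbF [j == i]eq_sym.
  by case: eqP => [<-|_] /=; rewrite ?mul1n ?ee ?subnn // mul0n subn0.
under eq_bigr => c _ do rewrite -/(m' _) -/(sch c _) IH // map_m'.
rewrite natr_sum; set cnd := [forall j, _].
transitivity (\sum_(c | hstrip a c) if cnd && (mdeg a == mdeg c + m i)%N
    then (kostka c [seq m j | j <- s])%:R else 0 : R).
  apply: eq_bigr => c ac; have ca := hstrip_mdeg ac.
  have -> : (mdeg a == (mdeg c + m i)%N) = ((mdeg a - mdeg c)%N == m i) by apply/eqP/eqP; lia.
  case: leqP => em; first by rewrite supp_m'.
  by rewrite gtn_eqF // andbF.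
case: cnd => /=; last by rewrite big1.
by rewrite -big_mkcondr.
Qed.

End Coefficients.

(** * Tableaux *)

Lemma sum_ord_lt n k : (k <= n)%N -> (\sum_(j < n | (j < k)%N) 1 = k)%N.
Proof. by move=> kn; rewrite -(big_ord_widen n (fun=> 1%N) kn) sum1_card card_ord. Qed.

(** Used to replace the cells of a tableau row with entry below a bound by their number, which
    becomes a row length. *)
Lemma initial_segment n (P : pred 'I_n) :
  (forall i j : 'I_n, (i <= j)%N -> P j -> P i) ->
  forall j : 'I_n, P j = (j < \sum_(i < n | P i) 1)%N.
Proof.
move=> dec j; apply/idP/idP => [Pj|].
  rewrite -{1}(sum_ord_lt (ltn_ord j)) big_mkcond [X in (_ <= X)%N]big_mkcond /=.
  apply: leq_sum => i _; rewrite ltnS; case: (leqP i j) => // ij.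
  by rewrite (dec _ _ ij Pj).
apply: contraLR => Pj; rewrite -leqNgt -[X in (_ <= X)%N](sum_ord_lt (ltnW (ltn_ord j))).
rewrite big_mkcond [X in (_ <= X)%N]big_mkcond /=.
apply: leq_sum => i _; case: ifP => // Pi; case: (ltnP i j) => // ji.
by rewrite (dec _ _ ji Pi) in Pj.
Qed.

Section Tableaux.
Variables (d N : nat) (R : comNzRingType) (x : nat -> R).
Implicit Types a c : shape d.
Local Notation box := ('I_d.+1 * 'I_d.+1)%type.
Local Notation filling := {ffun box -> 'I_N.+1}.
Implicit Types T : filling.

(** The entries of the tableau are less than [k], and the cells of the box outside
    of the shape [a] are filled with [k]. *)
Definition tableau k a T : bool :=
  [forall u : box, [&& (T u <= k)%N, (T u < k)%N == (u.2 < rowlen a u.1)%N &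
    [forall v : box, ((u.1 == v.1) && (u.2 <= v.2)%N ==> (T u <= T v)%N) &&
       ((u.2 == v.2) && (u.1 < v.1)%N ==> (T u < T v)%N || (T u == k :> nat))]]].

Lemma tableauP k a T :
  reflect [/\ forall u : box, (T u <= k)%N,
              forall u : box, (T u < k)%N = (u.2 < rowlen a u.1)%N,
              forall i j j' : 'I_d.+1, (j <= j')%N -> (T (i, j) <= T (i, j'))%N &
              forall (i i' j : 'I_d.+1), (i < i')%N -> (T (i, j) < T (i', j))%N || (T (i, j) == k :> nat)]
          (tableau k a T).
Proof.
apply: (iffP forallP) => [H|[H1 H2 H3 H4] [i j]].
  split=> [u|u|i j j' jj|i i' j ii].
  - by case/and3P: (H u).
  - by case/and3P: (H u) => _ /eqP.
  - by case/and3P: (H (i, j)) => _ _ /forallP/(_ (i, j'))/andP[]; rewrite /= eqxx jj.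
  - by case/and3P: (H (i, j)) => _ _ /forallP/(_ (i', j))/andP[_]; rewrite /= eqxx ii.
rewrite H1 H2 eqxx; apply/forallP => -[i' j'] /=; apply/andP; split; apply/implyP.
  by case/andP=> /eqP <-; exact: H3.
by case/andP=> /eqP <-; exact: H4.
Qed.

Definition tabsum k a : R :=
  \sum_(T | tableau k a T) \prod_(u | (T u < k)%N) x (T u).

Lemma card_tableau k a T : tableau k a T -> (\sum_(u | (T u < k)%N) 1 = mdeg a)%N.
Proof.
case/tableauP=> _ H _ _.
rewrite (eq_bigl (fun u : box => xpredT u.1 && (u.2 < rowlen a u.1)%N)) //.
rewrite -(pair_big_dep xpredT (fun i j : 'I_d.+1 => (j < rowlen a i)%N) (fun _ _ => 1%N)) /=.
rewrite mdeg_rowlen; apply: eq_bigr => i _; apply: sum_ord_lt.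
apply: leq_trans (leqnSn d); apply: leq_trans (mdeg_shape a).
by rewrite mdeg_rowlen (bigD1 i) //= leq_addr.
Qed.

Lemma rowlen_le a i : (rowlen a i <= d)%N.
Proof.
case: (ltnP i d.+1) => [id|/rowlen_ge -> //].
apply: leq_trans (mdeg_shape a).
by rewrite mdeg_rowlen (bigD1 (Ordinal id)) //= leq_addr.
Qed.

Section Step.
Variables (k : nat) (a : shape d).
Hypotheses (kN : (k < N)%N) (pa : is_part a).

(** Splitting off the largest letter [k]: [low] merges the cells holding it with the outside, marked
    [k + 1] before and [k] after; [up] separates them again by means of [a]. *)
Let low T : filling := [ffun u => inord (minn (T u) k)].
Let up T : filling :=
  [ffun u => if (T u < k)%N then T u else if (u.2 < rowlen a u.1)%N then inord k else inord k.+1].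
Let lowrow T i := (\sum_(u : box | (u.1 == i :> nat) && (T u < k)%N) 1)%N.
Let lowshape T : shape d := mkshape d (lowrow T).

Let lowE T (u : box) : low T u = minn (T u) k :> nat.
Proof. by rewrite ffunE inordK // ltnS geq_min (ltnW kN) orbT. Qed.

Let low_lt T (u : box) : (low T u < k)%N = (T u < k)%N.
Proof. by rewrite lowE gtn_min ltnn orbF. Qed.

Let upE T (u : box) : up T u =
  (if T u < k then (T u : nat) else if u.2 < rowlen a u.1 then k else k.+1)%N :> nat.
Proof.
by rewrite ffunE; case: ifP => // _; case: ifP => _; rewrite inordK // !ltnS ltnW.
Qed.

Let lowrowE T (i : 'I_d.+1) : lowrow T i = (\sum_(j < d.+1 | (T (i, j) < k)%N) 1)%N.
Proof.
rewrite /lowrow.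
rewrite (eq_bigl (fun u : box => (u.1 == i) && (T (u.1, u.2) < k)%N)); last by case.
rewrite -(pair_big_dep (pred1 i) (fun i j : 'I_d.+1 => (T (i, j) < k)%N) (fun _ _ => 1%N)) /=.
by rewrite big_pred1_eq.
Qed.

Let lowrow_ge T i : (d < i)%N -> lowrow T i = 0%N.
Proof. by move=> di; rewrite /lowrow big_pred0 // => -[j j'] /=; rewrite ltn_eqF // (leq_trans _ di). Qed.

Let lowshapeE T c : (forall i, lowrow T i <= rowlen c i)%N ->
  forall i, rowlen (lowshape T) i = lowrow T i.
Proof.
move=> le i; apply: rowlen_mk => [|j]; last exact: lowrow_ge.
by apply: leq_trans (mdeg_shape c); rewrite mdeg_rowlen; apply: leq_sum.
Qed.

Let down_ok T : tableau k.+1 a T ->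
  [/\ hstrip a (lowshape T), tableau k (lowshape T) (low T) & up (low T) = T].
Proof.
case/tableauP=> H1 H2 H3 H4.
have seg (i j : 'I_d.+1) : (T (i, j) < k)%N = (j < lowrow T i)%N.
  rewrite lowrowE; apply: (initial_segment (P := fun j => (T (i, j) < k)%N)) => j1 j2 /H3.
  by move=> /(_ i); apply: leq_ltn_trans.
have le i : (lowrow T i <= rowlen a i)%N.
  case: (ltnP i d.+1) => [id|di]; last by rewrite lowrow_ge.
  rewrite (lowrowE _ (Ordinal id)) -[X in (_ <= X)%N](@sum_ord_lt d.+1); last first.
    exact: leq_trans (rowlen_le _ _) _.
  rewrite big_mkcond [X in (_ <= X)%N]big_mkcond /=; apply: leq_sum => j _.
  by case: ifP => // lt; have /= <- := H2 (Ordinal id, j); rewrite ltnS (ltnW lt).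
have rE := lowshapeE le.
split; last 1 first.
- apply/ffunP => u; apply/val_inj; rewrite /= upE !lowE -H2.
  by have := H1 u; case: ifP => ?; [|case: ifP => ?]; lia.
(* If row [i] of the smaller shape were shorter than row [i + 1] of [a], the first column past it
   would hold [k] in row [i] and at most [k] below. *)
- apply/hstripP => i; rewrite rE le andbT leqNgt; apply/negP => lt.
  case: (ltnP i.+1 d.+1) => [id|di]; last by rewrite rowlen_ge in lt.
  have id' := ltnW id; have jd : (lowrow T i < d.+1)%N by apply: leq_trans lt _; apply: leqW; apply: rowlen_le.
  pose j := Ordinal jd; have Hs := seg (Ordinal id') j; rewrite /= ltnn in Hs.
  have := H4 (Ordinal id') (Ordinal id) j (ltnSn _).
  have := H2 (Ordinal id, j); rewrite /= lt => Ha.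
  have := H2 (Ordinal id', j); rewrite /= (leq_trans lt) ?(is_part_anti pa) // => Hb.
  by case/orP; lia.
apply/tableauP; split=> [u|[i j]|i j j' /H3 jj|i i' j /H4 ii].
- by rewrite lowE geq_minr.
- by rewrite low_lt /= rE -seg.
- by rewrite !lowE; have := jj i; lia.
by rewrite !lowE; have := ii j; lia.
Qed.

Let up_ok c T : hstrip a c -> tableau k c T ->
  [/\ tableau k.+1 a (up T), lowshape (up T) = c & low (up T) = T].
Proof.
move=> /hstripP ac /tableauP[H1 H2 H3 H4].
have ca (u : box) : (T u < k)%N -> (u.2 < rowlen a u.1)%N.
  by rewrite H2 => /leq_trans; apply; case/andP: (ac u.1).
split.
- apply/tableauP; split=> [u|u|i j j' jj|i i' j ii].
  + by rewrite upE; case: ifP => [/ltnW/leqW //|_]; case: ifP.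
  + rewrite upE; case: ifP => [lt|_]; first by rewrite (ca _ lt) ltnS (ltnW lt).
    by case: ifP => _; rewrite ?ltnSn ?ltnn.
  + rewrite !upE /=; have := H3 i _ _ jj.
    by do 4?[case: ifP => ?]; lia.
  rewrite !upE /=; have := H4 _ _ j ii; have := H1 (i, j).
  have := ca (i', j); have := H2 (i, j) => /= {}H2.
  have := ac i => /andP[ac1 _]; have := is_part_anti pa ii.
  by do 4?[case: ifP => ?]; lia.
- have rE i : lowrow (up T) i = rowlen c i.
    case: (ltnP i d.+1) => [id|di]; last by rewrite lowrow_ge // rowlen_ge.
    rewrite (lowrowE _ (Ordinal id)) -[RHS](@sum_ord_lt d.+1) ?leqW ?rowlen_le //.
    apply: eq_bigl => j; rewrite -(H2 (Ordinal id, j)) upE /=.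
    by case: ifP => // _; case: ifP => _; lia.
  by apply: shapeP => i; rewrite (lowshapeE (c := c)) // => j; rewrite rE.
apply/ffunP => u; apply/val_inj; rewrite /= lowE upE.
by have := H1 u; do 2?[case: ifP => ?]; lia.
Qed.

Lemma tabsumS :
  tabsum k.+1 a = \sum_(c : shape d | hstrip a c) x k ^+ (mdeg a - mdeg c) * tabsum k c.
Proof.
rewrite /tabsum; under [RHS]eq_bigr => c _ do rewrite mulr_sumr.
rewrite (pair_big_dep (hstrip a) (tableau k) (fun c T =>
   x k ^+ (mdeg a - mdeg c) * \prod_(u | (T u < k)%N) x (T u))) /=.
rewrite [RHS](reindex_onto (fun T => (lowshape T, low T)) (fun p => up p.2)) /=; last first.
  by case=> c T /= /andP[ac kc]; have [_ -> ->] := up_ok ac kc.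
apply: eq_big => [T|T tT].
  apply/idP/idP => [/down_ok[-> -> ->]|]; first by rewrite eqxx.
  by case/andP=> /andP[h1 h2] /eqP <-; have [] := up_ok h1 h2.
have [h1 h2 h3] := down_ok tT.
rewrite (bigID (fun u => (T u < k)%N)) /= mulrC; congr (_ * _).
  have -> : (mdeg a - mdeg (lowshape T) =
             \sum_(u | (T u < k.+1)%N && ~~ (T u < k)%N) 1)%N.
    rewrite -(card_tableau tT) -(card_tableau h2).
    rewrite (bigID (fun u : box => (T u < k)%N)) /=.
    rewrite [X in (_ - X)%N](eq_bigl (fun u : box => (T u < k.+1)%N && (T u < k)%N)) ?addKn //.
    by move=> u; rewrite low_lt andb_idl // => /leqW.
  rewrite sum1_card -prodr_const; apply: eq_bigr => u /andP[u1 u2].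
  by congr x; lia.
apply: eq_big => [u|u /andP[_ ltu]]; first by rewrite low_lt andb_idl // => /leqW.
by congr x; rewrite lowE; lia.
Qed.

End Step.

Lemma tabsumE k a : (k <= N)%N -> is_part a ->
  tabsum k a = sch a [seq x i | i <- rev (iota 0 k)].
Proof.
elim: k a => [|k IH] a kN pa.
  rewrite /sch /= /tabsum; have [->|a0] := eqVneq a bm0.
    rewrite (big_pred1 [ffun=> ord0]); first by rewrite big_pred0 // => u; rewrite ltn0.
    move=> T; apply/tableauP/eqP => [[H _ _ _]|->].
      by apply/ffunP => u; rewrite ffunE; apply/val_inj/eqP; rewrite -leqn0 H.
    by split=> *; rewrite !ffunE ?rowlen0 ?eqxx ?orbT.
  rewrite big_pred0 // => T; apply/negP => /tableauP[_ H _ _]; case/eqP: a0.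
  apply: shapeP => i; rewrite rowlen0; case: (ltnP i d.+1) => [id|/rowlen_ge //].
  by have := H (Ordinal id, ord0); rewrite ltn0 /= lt0n => /esym/negbFE/eqP.
rewrite tabsumS // -[k.+1]addn1 iotaD rev_cat map_cat add0n.
by apply: eq_bigr => c ac; rewrite IH ?(hstrip_partr ac) // ltnW.
Qed.

End Tableaux.

(** The largest variable comes first, as [skew] requires. *)
Definition vars N : seq {mpoly rat[N]} := rev [seq 'X_i | i <- enum 'I_N].

Section SchurTableaux.
Variables (d : nat) (la : seq nat).
Hypotheses (la_part : is_intpart la) (la_d : (sumn la <= d)%N).

Definition shape_of (s : seq nat) : shape d := mkshape d (nth 0%N s).

Lemma intpart_nth_anti i j : (i <= j)%N -> (nth 0 la j <= nth 0 la i)%N.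
Proof.
case/andP: la_part => sla _ ij; case: (ltnP j (size la)) => [jl|/(nth_default _) -> //].
have tr : transitive geq by move=> x y z /= h1 h2; apply: leq_trans h2 h1.
move: ij; rewrite leq_eqVlt => /predU1P[-> //|ij].
exact: (sorted_ltn_nth tr) sla _ _ (ltn_trans ij jl) jl ij.
Qed.

Lemma size_le_sumn : (size la <= sumn la)%N.
Proof.
case/andP: la_part => _; clear la_d la_part; elim: la => //= x s IH.
rewrite inE negb_or eq_sym -lt0n => /andP[x0 /IH]; lia.
Qed.

Let la_size : (size la <= d)%N. Proof. exact: leq_trans size_le_sumn la_d. Qed.

Lemma sumn_nth s n : (size s <= n)%N -> (\sum_(i < n) nth 0 s i = sumn s)%N.
Proof.
elim: s n => [|x s IH] n /=; first by move=> _; rewrite big1 // => i _; rewrite nth_nil.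
by case: n => // n sn; rewrite sum_ord_recl /= IH.
Qed.

Lemma sum_shape_of : (\sum_(i < d.+1) nth 0 la i = sumn la)%N.
Proof. exact: sumn_nth (leqW la_size). Qed.

Lemma rowlen_shape_of i : rowlen (shape_of la) i = nth 0%N la i.
Proof.
apply: rowlen_mk => [|j dj]; first by rewrite sum_shape_of.
by rewrite nth_default // (leq_trans la_size) // ltnW.
Qed.

Lemma mdeg_shape_of : mdeg (shape_of la) = sumn la.
Proof. by rewrite mdeg_mk sum_shape_of. Qed.

Lemma is_part_shape_of : is_part (shape_of la).
Proof. by apply/is_partP => i; rewrite !rowlen_shape_of intpart_nth_anti. Qed.

Variable N : nat.
Local Notation box := ('I_d.+1 * 'I_d.+1)%type.

(** Total because [tabsum] indexes letters by natural numbers; entries below [N] never reach the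
    default 0. *)
Definition var (i : nat) : {mpoly rat[N]} := if insub i is Some j then 'X_j else 0.

Lemma varE (i : 'I_N) : var i = 'X_i.
Proof. by rewrite /var valK. Qed.

Let emb (c : cell la) : box := (inord (val c).1, inord (val c).2).

Let cell_lt (c : cell la) : ((val c).1 < d.+1)%N /\ ((val c).2 < d.+1)%N.
Proof.
split; first by apply: leq_trans (ltn_ord _) _; apply: leqW.
apply: leq_trans (ltn_ord _) _; apply: leqW; apply: leq_trans la_d.
by case: (la) => //= x s; rewrite leq_addr.
Qed.

Let emb1 c : (emb c).1 = (val c).1 :> nat.
Proof. by rewrite inordK //; case: (cell_lt c). Qed.

Let emb2 c : (emb c).2 = (val c).2 :> nat.
Proof. by rewrite inordK //; case: (cell_lt c). Qed.

Let emb_inj : injective emb.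
Proof.
move=> c e E; apply/val_inj/eqP; rewrite -pair_eqE /= -!val_eqE /=.
by rewrite -!emb1 -!emb2 E !eqxx.
Qed.

Let emb_in c : ((emb c).2 < nth 0 la (emb c).1)%N.
Proof. by rewrite emb1 emb2; case: c. Qed.

Let emb_onto (u : box) : (u.2 < nth 0 la u.1)%N -> exists c, emb c = u.
Proof.
move=> u_in; have i_lt : (u.1 < size la)%N.
  by rewrite ltnNge; apply/negP => /(nth_default 0%N) E; rewrite E in u_in.
have j_lt : (u.2 < head 0 la)%N.
  by apply: leq_trans u_in _; rewrite -nth0; apply: intpart_nth_anti.
pose p := (Ordinal i_lt, Ordinal j_lt).
exists (Sub p (u_in : (p.2 < nth 0 la p.1)%N)).
by rewrite /emb /= !inord_val -surjective_pairing.
Qed.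

(** The value [N] is the mark that [tableau N] demands outside of the shape. *)
Let ext (T : {ffun cell la -> 'I_N}) : {ffun box -> 'I_N.+1} :=
  [ffun u => if [pick c | emb c == u] is Some c then widen_ord (leqnSn N) (T c) else ord_max].

Let ext_emb T c : ext T (emb c) = T c :> nat.
Proof. by rewrite ffunE; case: pickP => [e /eqP/emb_inj -> //|/(_ c)]; rewrite eqxx. Qed.

Let ext_out T (u : box) : ~~ (u.2 < nth 0 la u.1)%N -> ext T u = N :> nat.
Proof.
by move=> out; rewrite ffunE; case: pickP => // c /eqP E; move: out; rewrite -E emb_in.
Qed.

Let ext_lt T (u : box) : (ext T u < N)%N = (u.2 < nth 0 la u.1)%N.
Proof.
case: (boolP (u.2 < _)%N) => [/emb_onto[c <-]|/ext_out ->]; last by rewrite ltnn.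
by rewrite ext_emb ltn_ord.
Qed.

Let ext_inj : injective ext.
Proof.
by move=> T T' E; apply/ffunP => c; apply/val_inj; rewrite /= -!ext_emb E.
Qed.

Let semistandardP (T : {ffun cell la -> 'I_N}) :
  reflect (forall c e : cell la,
      (((val c).1 = (val e).1 :> nat) -> ((val c).2 <= (val e).2)%N -> (T c <= T e)%N) /\
      (((val c).2 = (val e).2 :> nat) -> ((val c).1 < (val e).1)%N -> (T c < T e)%N))
    (semistandard T).
Proof.
apply: (iffP forallP) => [H c e|H c].
  have /forallP/(_ e)/andP[/implyP H1 /implyP H2] := H c.
  by split=> /val_inj E lt; [apply: H1 | apply: H2]; rewrite E eqxx.
apply/forallP => e; have [H1 H2] := H c e.
by apply/andP; split; apply/implyP => /andP[/eqP E lt]; [apply: H1 | apply: H2]; rewrite ?E.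
Qed.

Let ext_tableau T : semistandard T -> tableau N (shape_of la) (ext T).
Proof.
move/semistandardP=> H; apply/tableauP; split=> [u|u|i j j' jj|i i' j ii].
- by rewrite -ltnS.
- by rewrite ext_lt rowlen_shape_of.
- have [|out] := boolP ((i, j').2 < nth 0 la (i, j').1)%N; last by rewrite (ext_out _ out) -ltnS.
  move=> in'; have in_ : ((i, j).2 < nth 0 la (i, j).1)%N by apply: leq_ltn_trans in'.
  have [c Ec] := emb_onto in_; have [e Ee] := emb_onto in'.
  rewrite -Ec -Ee !ext_emb; apply: (H c e).1; first by rewrite -!emb1 Ec Ee.
  by rewrite -!emb2 Ec Ee.
have [in_|out] := boolP ((i, j).2 < nth 0 la (i, j).1)%N; last first.
  by rewrite (ext_out _ out) eqxx orbT.
have [in'|out'] := boolP ((i', j).2 < nth 0 la (i', j).1)%N; last first.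
  by rewrite (ext_out _ out') ext_lt in_.
have [c Ec] := emb_onto in_; have [e Ee] := emb_onto in'.
rewrite -Ec -Ee !ext_emb; apply/orP; left; apply: (H c e).2; first by rewrite -!emb2 Ec Ee.
by rewrite -!emb1 Ec Ee.
Qed.

Let ext_onto T' : tableau N (shape_of la) T' -> exists2 T, semistandard T & ext T = T'.
Proof.
case/tableauP=> H1 H2 H3 H4.
have lt c : (T' (emb c) < N)%N by rewrite H2 rowlen_shape_of emb_in.
pose T := [ffun c => Ordinal (lt c)].
exists T.
  apply/semistandardP => c e; rewrite !ffunE /=; split=> E le.
    have {}E : (emb c).1 = (emb e).1 by apply/val_inj; rewrite /= !emb1.
    move: le; rewrite -!emb2; case: (emb c) (emb e) E => [i j] [i' j'] /= <-.
    exact: H3.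
  have {}E : (emb c).2 = (emb e).2 by apply/val_inj; rewrite /= !emb2.
  move: le (lt c); rewrite -!emb1; case: (emb c) (emb e) E => [i j] [i' j'] /= <-.
  by move=> ii; case/orP: (H4 _ _ j ii) => [//|/eqP->]; rewrite ltnn.
apply/ffunP => u; apply/val_inj => /=.
have [/emb_onto[c <-]|out] := boolP (u.2 < nth 0 la u.1)%N.
  by rewrite ext_emb ffunE.
rewrite ext_out //; apply/eqP; rewrite eqn_leq H1 andbT leqNgt H2 rowlen_shape_of.
exact: out.
Qed.

Lemma schur_tabsum : schur la N = tabsum N var N (shape_of la).
Proof.
have img : [set T' | tableau N (shape_of la) T'] =
           ext @: [set T | semistandard T].
  apply/setP => T'; rewrite inE; apply/idP/imsetP => [/ext_onto[T sT <-]|[T sT ->]].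
    by exists T; rewrite ?inE.
  by apply: ext_tableau; rewrite inE in sT.
rewrite /tabsum (eq_bigl (fun T' => T' \in [set T' | tableau N (shape_of la) T'])); last first.
  by move=> T'; rewrite inE.
rewrite img big_imset /=; last by move=> T T' _ _; apply: ext_inj.
apply: eq_big => [T|T _]; first by rewrite inE.
transitivity (\prod_(u in emb @: [set: cell la]) var (ext T u)).
  rewrite big_imset /=; last by move=> ? ? _ _; apply: emb_inj.
  by apply: eq_big => [c|c _]; rewrite ?inE // ext_emb varE.
apply: eq_bigl => u; rewrite ext_lt; apply/imsetP/idP => [[c _ ->]|/emb_onto[c <-]].
  exact: emb_in.
by exists c; rewrite ?inE.
Qed.

Lemma schur_sch : schur la N = sch (shape_of la) (vars N).
Proof.
rewrite schur_tabsum tabsumE // ?is_part_shape_of // map_rev; congr (sch _ (rev _)).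
by rewrite -val_enum_ord -map_comp; apply: eq_map => i /=; rewrite varE.
Qed.

End SchurTableaux.

Lemma hcompE (R : comNzRingType) (xs : seq R) k :
  hcomp xs k = \sum_(f : {ffun 'I_(size xs) -> 'I_k.+1} | (\sum_(i < size xs) f i == k)%N)
                 \prod_(i < size xs) xs`_i ^+ f i.
Proof.
(* The geometric series of x, cut at degree [k]; the cut does not affect the coefficients of the
   product up to degree [k]. *)
pose F (x : R) : {poly R} := \sum_(j < k.+1) (x ^+ j) *: 'X^j.
have FE i : (i <= k)%N -> hcomp xs i = (\prod_(x <- xs) F x)`_i.
  elim: xs i => [|x xs IH] i ik /=; first by rewrite big_nil coef1.
  rewrite big_cons coefM; apply: eq_bigr => j _; rewrite -IH ?(leq_trans (leq_subr _ _)) //.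
  have jk : (j < k.+1)%N by apply: leq_trans (ltn_ord j) _.
  rewrite coef_sum (bigD1 (Ordinal jk)) //= coefZ coefXn eqxx mulr1 big1 ?addr0 // => l.
  by rewrite -val_eqE /= coefZ coefXn eq_sym => /negbTE->; rewrite mulr0.
rewrite FE // (big_nth 0) big_mkord bigA_distr_bigA coef_sum /= [RHS]big_mkcond.
apply: eq_bigr => f _.
have -> : \prod_(i < size xs) (xs`_i ^+ f i *: 'X^(f i)) =
          (\prod_(i < size xs) xs`_i ^+ f i) *: 'X^(\sum_(i < size xs) f i).
  by rewrite scaler_prod; congr (_ *: _); rewrite -prodrXr.
by rewrite coefZ coefXn eq_sym; case: eqP; rewrite ?mulr1 ?mulr0.
Qed.

Lemma size_vars N : size (vars N) = N.
Proof. by rewrite size_rev size_map -cardE card_ord. Qed.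

Lemma nth_vars N (i : 'I_N) : (vars N)`_i = 'X_(rev_ord i).
Proof.
have sz : size [seq ('X_j : {mpoly rat[N]}) | j <- enum 'I_N] = N.
  by rewrite size_map -cardE card_ord.
rewrite /vars nth_rev sz // (nth_map i) -?cardE ?card_ord ?rev_ord_proof //.
by congr ('X_ _); apply/val_inj; rewrite /= nth_enum_ord // rev_ord_proof.
Qed.

Lemma hsum_hcomp k N : hsum k N = hcomp (vars N) k.
Proof.
rewrite hcompE size_vars.
(* [rev_ord] undoes the reversal in [vars]. *)
pose h (f : {ffun 'I_N -> 'I_k.+1}) : 'X_{1..N < k.+1} :=
  insubd bm0 [multinom (f (rev_ord i) : nat) | i < N].
pose h' (m : 'X_{1..N < k.+1}) : {ffun 'I_N -> 'I_k.+1} := [ffun i => inord (m (rev_ord i))].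
have mdegE' (f : {ffun 'I_N -> 'I_k.+1}) :
    mdeg [multinom (f (rev_ord i) : nat) | i < N] = (\sum_i f i)%N.
  rewrite mdegE (reindex_inj rev_ord_inj) /=.
  by apply: eq_bigr => i _; rewrite mnmE rev_ordK.
have hE (f : {ffun 'I_N -> 'I_k.+1}) : (\sum_i f i == k)%N -> bmnm (h f) = [multinom (f (rev_ord i) : nat) | i < N].
  by move=> /eqP fk; rewrite /h insubdK // unfold_in mdegE' fk.
have m_le (m : 'X_{1..N < k.+1}) i : (m i < k.+1)%N.
  apply: leq_ltn_trans (bmdeg m); rewrite mdegE (bigD1 i) //=; exact: leq_addr.
rewrite /hsum (reindex_onto h h') /=; last first.
  move=> m /eqP mk; have sumE : (\sum_i h' m i == k)%N.
    apply/eqP; rewrite -[RHS]mk mdegE (reindex_inj rev_ord_inj) /=; apply: eq_bigr => i _.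
    by rewrite ffunE rev_ordK inordK.
  apply/val_inj/mnmP => i; rewrite /= hE // mnmE ffunE rev_ordK inordK //.
apply: eq_big => [f|f /andP[/eqP fk /eqP hf]].
  apply/andP/idP => [[/eqP fk /eqP <-]|fk].
    apply/eqP; rewrite -[RHS]fk mdegE (reindex_inj rev_ord_inj) /=; apply: eq_bigr => i _.
    by rewrite ffunE rev_ordK inordK.
  split; first by rewrite hE // mdegE'.
  by apply/eqP/ffunP => i; rewrite ffunE hE // mnmE rev_ordK inord_val.
rewrite mpolyXE_id (reindex_inj rev_ord_inj) /=; apply: eq_bigr => i _.
by rewrite nth_vars -[in RHS]hf ffunE inordK.
Qed.

(** * Power sums and complete functions *)

Section Newton.
Variable R : comNzRingType.
Implicit Types (x : R) (xs : seq R).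

Definition powsum xs k : R := \sum_(x <- xs) x ^+ k.

Lemma hcomp0 xs : hcomp xs 0 = 1.
Proof. by elim: xs => //= x xs IH; rewrite big_ord_recl big_ord0 addr0 IH mul1r. Qed.

Lemma hcomp1 xs : hcomp xs 1 = \sum_(x <- xs) x.
Proof.
elim: xs => /= [|x xs IH]; first by rewrite big_nil.
by rewrite !big_ord_recl big_ord0 /= hcomp0 IH big_cons mul1r expr1 mulr1 addr0 addrC.
Qed.

Lemma hcomp_cons x xs k :
  hcomp (x :: xs) k = \sum_(j < k.+1) x ^+ j * hcomp xs (k - j).
Proof. by []. Qed.

Lemma hcomp_consS x xs k :
  hcomp (x :: xs) k.+1 = hcomp xs k.+1 + x * hcomp (x :: xs) k.
Proof.
rewrite hcomp_cons big_ord_recl mul1r subn0; congr (_ + _); rewrite big_distrr /=.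
by apply: eq_bigr => i _; rewrite exprS mulrA.
Qed.

Local Arguments hcomp : simpl never.

Lemma newton xs k :
  k%:R * hcomp xs k = \sum_(i < k) powsum xs i.+1 * hcomp xs (k - i.+1).
Proof.
elim: xs k => [|x xs IHx] k.
  case: k => [|k]; first by rewrite big_ord0 mul0r.
  by rewrite mulr0 big1 // => i _; rewrite /powsum big_nil mul0r.
elim: k => [|k IHk]; first by rewrite big_ord0 mul0r.
(* This is the right-hand side after [hcomp_consS] has been applied to each of its complete
   functions of positive degree. *)
transitivity (\sum_(i < k.+1) powsum (x :: xs) i.+1 * hcomp xs (k - i) +
              x * \sum_(i < k) powsum (x :: xs) i.+1 * hcomp (x :: xs) (k - i.+1)).
  rewrite -IHk; transitivity (\sum_(i < k.+1) x ^+ i.+1 * hcomp xs (k - i) +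
     \sum_(i < k.+1) powsum xs i.+1 * hcomp xs (k.+1 - i.+1) + x * (k%:R * hcomp (x :: xs) k)).
    rewrite -IHx hcomp_consS.
    have -> : \sum_(i < k.+1) x ^+ i.+1 * hcomp xs (k - i) = x * hcomp (x :: xs) k.
      by rewrite hcomp_cons big_distrr /=; apply: eq_bigr => i _; rewrite exprS mulrA.
    by rewrite -natr1; ring.
  rewrite -big_split; congr (_ + _); apply: eq_bigr => i _ /=.
  by rewrite /powsum big_cons mulrDl subSS.
rewrite !big_ord_recr /= !subnn !hcomp0 addrAC; congr (_ + _).
rewrite big_distrr -big_split /=.
apply: eq_bigr => i _; rewrite subSS.
have -> : (k - i = (k - i.+1).+1)%N by rewrite subnSK.
by rewrite hcomp_consS; ring.
Qed.

End Newton.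

Lemma rmorph_hcomp (R S : comNzRingType) (f : {rmorphism R -> S}) xs k :
  f (hcomp xs k) = hcomp (map f xs) k.
Proof.
elim: xs k => [|x xs IH] k /=; first by rewrite rmorph_nat.
by rewrite rmorph_sum; apply: eq_bigr => j _; rewrite rmorphM rmorphXn IH.
Qed.

Lemma psum_powsum k N : psum k N = powsum (vars N) k.
Proof. by rewrite /powsum big_rev big_map big_enum. Qed.

Section Expressible.

(** [genpart psum] and [genpart hsum] are convertible to [psum_part] and [hsum_part]. *)
Definition genpart (g : nat -> symfun) (mu : intpart) : symfun :=
  fun N => \prod_(k <- mu) g k N.

(** The condition under which the list picked by [expansion] really is an expansion. *)
Definition expressible (g : nat -> symfun) (f : symfun) : Prop :=
  exists e, expands (genpart g) f e.

Variable g : nat -> symfun.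

Lemma expressible_ext f f' :
  (forall N, f N = f' N) -> expressible g f -> expressible g f'.
Proof. by move=> ff' [e He]; exists e => N; rewrite -ff'. Qed.

Lemma nil_intpart : is_intpart [::]. Proof. by []. Qed.

Lemma merge_intpart (mu nu : intpart) : is_intpart (sort geq (mu ++ nu)).
Proof.
apply/andP; split; first by apply: sort_sorted => x y /=; exact: leq_total.
rewrite mem_sort mem_cat negb_or.
by case: mu nu => [mu /= /andP[_ ->]] [nu /= /andP[_ ->]].
Qed.

Lemma expressible0 : expressible g (fun=> 0).
Proof. by exists [::] => N; rewrite big_nil. Qed.

Lemma expressible1 : expressible g (fun=> 1).
Proof.
exists [:: (1, IntPart nil_intpart)] => N.
by rewrite big_seq1 /genpart /= big_nil scale1r.
Qed.

Lemma expressible_gen k : (0 < k)%N -> expressible g (g k).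
Proof.
move=> k0; have pk : is_intpart [:: k] by rewrite /is_intpart inE eq_sym -lt0n k0.
by exists [:: (1, IntPart pk)] => N; rewrite big_seq1 /genpart /= big_seq1 scale1r.
Qed.

Lemma expressibleD f f' :
  expressible g f -> expressible g f' -> expressible g (fun N => f N + f' N).
Proof. by move=> [e He] [e' He']; exists (e ++ e') => N; rewrite big_cat He He'. Qed.

Lemma expressibleZ (c : rat) f : expressible g f -> expressible g (fun N => c *: f N).
Proof.
move=> [e He]; exists [seq (c * t.1, t.2) | t <- e] => N.
by rewrite He big_map scaler_sumr; apply: eq_bigr => t _; rewrite scalerA.
Qed.

Lemma expressibleM f f' :
  expressible g f -> expressible g f' -> expressible g (fun N => f N * f' N).
Proof.
move=> [e He] [e' He'].
exists [seq (t.1 * t'.1, IntPart (merge_intpart t.2 t'.2)) | t <- e, t' <- e'] => N.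
rewrite He He' big_allpairs_dep mulr_suml; apply: eq_bigr => t _.
rewrite mulr_sumr; apply: eq_bigr => t' _.
rewrite -scalerAl -scalerAr scalerA; congr (_ *: _).
by rewrite /genpart /= (perm_big _ (permEl (perm_sort _ _))) big_cat.
Qed.

Lemma expressible_sum (I : eqType) (r : seq I) (F : I -> symfun) :
  (forall i, i \in r -> expressible g (F i)) ->
  expressible g (fun N => \sum_(i <- r) F i N).
Proof.
elim: r => [|i r IH] H.
  by apply: expressible_ext expressible0 => N; rewrite big_nil.
apply: (@expressible_ext (fun N => F i N + \sum_(i <- r) F i N)) => [N|].
  by rewrite big_cons.
apply: expressibleD; first by apply: H; rewrite mem_head.
by apply: IH => j jr; apply: H; rewrite inE jr orbT.
Qed.

Lemma expressible_prod (I : eqType) (r : seq I) (F : I -> symfun) :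
  (forall i, i \in r -> expressible g (F i)) ->
  expressible g (fun N => \prod_(i <- r) F i N).
Proof.
elim: r => [|i r IH] H.
  by apply: expressible_ext expressible1 => N; rewrite big_nil.
apply: (@expressible_ext (fun N => F i N * \prod_(i <- r) F i N)) => [N|].
  by rewrite big_cons.
apply: expressibleM; first by apply: H; rewrite mem_head.
by apply: IH => j jr; apply: H; rewrite inE jr orbT.
Qed.

End Expressible.

Lemma intpart_gt0 (mu : intpart) k : k \in parts mu -> (0 < k)%N.
Proof.
case: mu => mu /= /andP[_ mu0] kmu; rewrite lt0n.
by apply: contra mu0 => /eqP <-.
Qed.

Lemma expressible_trans g g' f : (forall k, (0 < k)%N -> expressible g' (g k)) ->
  expressible g f -> expressible g' f.
Proof.
move=> gg' [e He]; apply: (expressible_ext (fun N => esym (He N))).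
apply: expressible_sum => t _; apply: expressibleZ; apply: expressible_prod => k kt.
exact: gg' (intpart_gt0 kt).
Qed.

Lemma hsum0 N : hsum 0 N = 1.
Proof. by rewrite hsum_hcomp hcomp0. Qed.

(** Newton's identity solved for h_k, with a division by k. *)
Lemma expressible_hsum_psum k : expressible psum (hsum k).
Proof.
elim/ltn_ind: k => -[|k] IH.
  by apply: expressible_ext (expressible1 _) => N; rewrite hsum0.
apply: (@expressible_ext _ (fun N => (k.+1%:R^-1 : rat) *:
    \sum_(i <- enum 'I_k.+1) psum i.+1 N * hsum (k.+1 - i.+1) N)) => [N|].
  rewrite big_enum /=.
  have := newton (vars N) k.+1; rewrite -hsum_hcomp.
  under [RHS]eq_bigr => i _ do rewrite -psum_powsum -hsum_hcomp.
  move=> <-; rewrite -mpolyC_nat mul_mpolyC scalerA mulVf ?scale1r //.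
  by rewrite Num.Theory.pnatr_eq0.
apply: expressibleZ; apply: expressible_sum => i _.
apply: expressibleM; first exact: expressible_gen.
by apply: IH; have := ltn_ord i; lia.
Qed.

(** Newton's identity solved for its last power sum, whose cofactor is h_0 = 1. *)
Lemma expressible_psum_hsum k : (0 < k)%N -> expressible hsum (psum k).
Proof.
elim/ltn_ind: k => -[//|k] IH _.
apply: (@expressible_ext _ (fun N => (k.+1%:R : rat) *: hsum k.+1 N +
    (-1) *: \sum_(i <- enum 'I_k) psum i.+1 N * hsum (k.+1 - i.+1) N)) => [N|].
  rewrite big_enum /=.
  have := newton (vars N) k.+1; rewrite -hsum_hcomp.
  under [RHS]eq_bigr => i _ do rewrite -psum_powsum -hsum_hcomp.
  rewrite -mpolyC_nat mul_mpolyC => ->; rewrite big_ord_recr /= subnn hsum0 mulr1.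
  by rewrite scaleN1r addrAC subrr add0r.
apply: expressibleD; first by apply: expressibleZ; apply: expressible_gen.
apply: expressibleZ; apply: expressible_sum => i _.
apply: expressibleM; first by apply: IH; rewrite // ltnS; exact: ltn_ord.
by apply: expressible_gen; have := ltn_ord i; lia.
Qed.

Lemma expressible_hsum k : expressible hsum (hsum k).
Proof.
case: k => [|k]; last exact: expressible_gen.
by apply: expressible_ext (expressible1 _) => N; rewrite hsum0.
Qed.

(* By induction on [rowwt], as the Kostka matrix is unitriangular for it. *)
Lemma expressible_sch d (a : shape d) :
  is_part a -> expressible hsum (fun N => sch a (vars N)).
Proof.
move: {2}(rowwt a) (erefl (rowwt a)) => w; elim/ltn_ind: w a => w IH a wE pa.
pose ms := rev (a : 'X_{1..d.+1}).
have ms_d : (sumn ms <= d)%N.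
  by rewrite sumn_rev sumnE; exact: mdeg_shape.
apply: (@expressible_ext _ (fun N => \prod_(m <- ms) hsum m N +
   (-1) *: \sum_(b <- enum {: shape d} | b != a) (kostka b ms)%:R *: sch b (vars N))) => [N|].
  under eq_bigr => m _ do rewrite hsum_hcomp.
  rewrite (prod_hcomp _ ms_d) big_enum_cond /= (bigD1 a) //= kostka_shape // mul1r.
  rewrite scaleN1r -addrA -sumrN -big_split big1 /= ?addr0 // => b _.
  by rewrite -[_%:R * _]/(_%:R * _) -mpolyC_nat mul_mpolyC subrr.
apply: expressibleD; first by apply: expressible_prod => m _; exact: expressible_hsum.
apply: expressibleZ.
apply: (@expressible_ext _ (fun N => \sum_(b <- [seq b <- enum {: shape d} | b != a])
   (kostka b ms)%:R *: sch b (vars N))) => [N|]; first by rewrite big_filter.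
apply: expressible_sum => b; rewrite mem_filter => /andP[ba _].
have [->|kb] := eqVneq (kostka b ms) 0%N.
  by apply: expressible_ext (expressible0 _) => N; rewrite scale0r.
apply: expressibleZ; apply: (IH (rowwt b)) => //; last exact: kostka_is_part kb.
by rewrite -wE; exact: kostka_shape_lt kb ba.
Qed.

Lemma expressible_schur (nu : intpart) : expressible hsum (schur nu).
Proof.
have nup : is_intpart nu by case: nu.
apply: expressible_ext (expressible_sch (is_part_shape_of nup (leqnn _))) => N.
by rewrite (schur_sch nup (leqnn _)).
Qed.

Lemma expansion_spec g f : expressible g f ->
  expands (genpart g) f (expansion (genpart g) f).
Proof. by move=> Ef; apply: (ClassicalEpsilon.epsilon_spec (inhabits [::]) (expands (genpart g) f)). Qed.

(** * The plethysm *)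

Lemma mdeg_bm0 d : mdeg (bm0 : shape d) = 0%N.
Proof. exact: mdeg0. Qed.

Section Plethysm.
Variable R : comNzRingType.
Implicit Types xs : seq R.

(** The monomials of h_2 as an alphabet, so that f[h_2[X]] is [f] evaluated at [pairs]. Their order
    follows x^2 + h_2[X] + x h_1[X], ready for [skew_cons] and [skew_cat]. *)
Fixpoint pairs (S : comNzRingType) (xs : seq S) : seq S :=
  if xs is x :: ys then x * x :: pairs ys ++ [seq x * y | y <- ys] else [::].

Lemma sum_pairs xs : \sum_(z <- pairs xs) z = hcomp xs 2.
Proof.
elim: xs => [|x xs IH]; first by rewrite big_nil.
rewrite [pairs _]/= big_cons big_cat IH big_map -mulr_sumr -hcomp1.
rewrite hcomp_consS hcomp_consS hcomp0 mulr1 /=; ring.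
Qed.

Lemma map_pairs (S : comNzRingType) (f : R -> S) xs :
  {morph f : x y / x * y} -> map f (pairs xs) = pairs (map f xs).
Proof.
move=> fM; elim: xs => //= x xs IH; rewrite fM map_cat IH -!map_comp.
by congr (_ :: _ ++ _); apply: eq_map => y /=; rewrite fM.
Qed.

Lemma sch0 d xs : sch (bm0 : shape d) xs = 1.
Proof. by rewrite /sch skew_eq_mdeg ?is_part0 ?eqxx. Qed.

Lemma sch_homog d (a : shape d) (x : R) xs :
  sch a [seq x * y | y <- xs] = x ^+ mdeg a * sch a xs.
Proof.
elim: xs a => [|y xs IH] a.
  rewrite /sch /=; have [->|_] := eqVneq a bm0; last by rewrite !mulr0.
  by rewrite mdeg_bm0 expr0 mul1r.
rewrite /sch /= mulr_sumr; apply: eq_bigr => c ac; rewrite -!/(sch _ _) IH.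
have -> : x ^+ mdeg a = x ^+ (mdeg a - mdeg c) * x ^+ mdeg c.
  by rewrite -exprD subnK // hstrip_mdeg.
by rewrite exprMn; ring.
Qed.

End Plethysm.

Lemma two_intpart : is_intpart [:: 2%N]. Proof. by []. Qed.

(** Pieri's rule at the empty shape: a horizontal strip added to it is a single row. *)
Lemma schur_two N : schur [:: 2%N] N = hcomp (vars N) 2.
Proof.
rewrite (schur_sch (d := 2) two_intpart) //.
rewrite -[RHS]mulr1 -(sch0 2 (vars N)) pieri ?mdeg_bm0 //.
rewrite (big_pred1 (shape_of 2 [:: 2%N])) // => c.
apply/andP/eqP => [[c0 /eqP c2]|->].
  have z i : rowlen c i.+1 = 0%N.
    by move/hstripP: c0 => /(_ i)/andP[]; rewrite rowlen0 leqn0 => /eqP.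
  have E : mdeg c = rowlen c 0.
    by rewrite mdeg_rowlen sum_ord_recl big1 ?addn0.
  apply: shapeP => i; rewrite rowlen_shape_of //.
  by case: i => [|i]; [rewrite -E c2 | rewrite z /= nth_nil].
split; last by rewrite mdeg_shape_of.
apply/hstripP => i; rewrite rowlen0 !rowlen_shape_of //=.
by rewrite nth_nil.
Qed.

Lemma psum_plethysm_two k N :
  psum_plethysm k (schur [:: 2%N]) N = hcomp [seq x ^+ k | x <- vars N] 2.
Proof.
rewrite /psum_plethysm schur_two rmorph_hcomp; congr hcomp.
rewrite /vars -!map_rev -!map_comp; apply: eq_map => i /=.
by rewrite comp_mpolyXU -tnth_nth tnth_mktuple.
Qed.

Lemma psum_plethysm_powsum k N :
  psum_plethysm k (schur [:: 2%N]) N = powsum (pairs (vars N)) k.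
Proof.
rewrite psum_plethysm_two -sum_pairs -map_pairs; last by move=> x y; rewrite exprMn.
by rewrite big_map.
Qed.

(** Newton's identity in degree two, on the letters x^k, gives 2 (p_k o h_2) = p_k^2 + p_(2k). *)
Lemma expressible_psum_plethysm k : (0 < k)%N ->
  expressible hsum (psum_plethysm k (schur [:: 2%N])).
Proof.
move=> k0; apply: (@expressible_ext _ (fun N => (2%:R^-1 : rat) *:
   (psum k N * psum k N + psum (k + k) N))) => [N|].
  rewrite psum_plethysm_two; set ys := map _ _.
  have := newton ys 2; rewrite !big_ord_recr big_ord0 /= add0r hcomp0 mulr1.
  rewrite (hcomp1 ys).
  have p1 : powsum ys 1 = psum k N.
    by rewrite psum_powsum /powsum big_map; apply: eq_bigr => x _; rewrite expr1.
  have p2 : powsum ys 2 = psum (k + k) N.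
    by rewrite psum_powsum /powsum big_map; apply: eq_bigr => x _; rewrite -exprM muln2 addnn.
  have -> : \sum_(x <- ys) x = psum k N.
    by rewrite -p1 /powsum; apply: eq_bigr => x _; rewrite expr1.
  rewrite p1 p2 => <-; rewrite -mpolyC_nat mul_mpolyC scalerA mulVf ?scale1r //.
apply: expressibleZ; apply: expressibleD.
  by apply: expressibleM; apply: expressible_psum_hsum.
by apply: expressible_psum_hsum; rewrite addn_gt0 k0.
Qed.

Section Expansion.
Variable nu : intpart.

Let nu_part : is_intpart nu. Proof. by case: nu. Qed.

Let schur_expansion :
  expands psum_part (schur nu) (expansion psum_part (schur nu)).
Proof.
apply: (@expansion_spec psum); apply: expressible_trans (expressible_schur nu) => k _.
exact: expressible_hsum_psum.
Qed.

Lemma expressible_plethysm :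
  expressible hsum (plethysm (schur nu) (schur [:: 2%N])).
Proof.
apply: expressible_sum => t _; apply: expressibleZ; apply: expressible_prod => k kt.
exact: expressible_psum_plethysm (intpart_gt0 kt).
Qed.

(** The power sum expansion of s_nu is taken in as many variables as there are pairs. Substituting
    the pairs for the variables turns each p_k into p_k o h_2. *)
Lemma plethysm_sch d N : (sumn nu <= d)%N ->
  plethysm (schur nu) (schur [:: 2%N]) N = sch (shape_of d nu) (pairs (vars N)).
Proof.
move=> nu_d; pose zs := pairs (vars N); pose lq := in_tuple (rev zs).
have lqE : [seq p \mPo lq | p <- vars (size (rev zs))] = zs.
  rewrite /vars map_rev -map_comp -[RHS]revK; congr rev.
  rewrite -[RHS](map_tnth_enum lq); apply: eq_map => i /=.
  by rewrite comp_mpolyXU -tnth_nth.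
have := congr1 (fun p => p \mPo lq) (schur_expansion (size (rev zs))).
rewrite (schur_sch nu_part nu_d) rmorph_skew lqE -/zs /sch => ->.
rewrite raddf_sum; apply: eq_bigr => t _ /=.
rewrite comp_mpolyZ rmorph_prod; congr (_ *: _); apply: eq_bigr => k _.
rewrite psum_plethysm_powsum psum_powsum -[in LHS]/zs -{1}lqE /powsum rmorph_sum big_map.
by apply: eq_bigr => x _; rewrite rmorphXn.
Qed.

End Expansion.

(** * Hall products as coefficients in the Schur basis *)

Lemma mcoeff_part_schur d (la mu : intpart) : (sumn la <= d)%N ->
  mcoeff_part mu (schur la) = (kostka (shape_of d la) (rev mu))%:R.
Proof.
have la_part : is_intpart la by case: la.
move=> la_d; rewrite /mcoeff_part (schur_sch la_part la_d) /vars -map_rev.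
rewrite mcoeff_sch ?rev_uniq ?enum_uniq //.
have -> : [forall j, (j \notin rev (enum 'I_(size mu))) ==>
             ([multinom nth 0%N mu i | i < size mu] j == 0%N)].
  by apply/forallP => j; rewrite mem_rev mem_enum.
congr (kostka _ _)%:R; rewrite map_rev; congr rev.
rewrite -[RHS](mkseq_nth 0%N) /mkseq -val_enum_ord -map_comp.
by apply: eq_map => i /=; rewrite mnmE.
Qed.

Lemma hsum_part_sch d (mu : intpart) N : (sumn mu <= d)%N ->
  hsum_part mu N = \sum_(a : shape d) (kostka a (rev mu))%:R * sch a (vars N).
Proof.
move=> mu_d; rewrite -prod_hcomp ?sumn_rev // big_rev.
by apply: eq_bigr => k _; rewrite hsum_hcomp.
Qed.

(** The bound [D] is there because the expansion chosen in [hall] may contain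
    terms of any degree, even if [f] is homogeneous. *)
Lemma schur_expansion_hall f : expressible hsum f ->
  exists D, forall d, (D <= d)%N -> exists c : shape d -> rat,
    (forall N, f N = \sum_a c a *: sch a (vars N)) /\
    (forall la : intpart, (sumn la <= d)%N -> hall f (schur la) = c (shape_of d la)).
Proof.
move=> /expansion_spec ef; set e := expansion _ _ in ef.
exists (\sum_(t <- e) sumn t.2)%N => d e_d.
exists (fun a => \sum_(t <- e) t.1 * (kostka a (rev t.2))%:R); split=> [N|la la_d].
  rewrite ef; under [RHS]eq_bigr => a _ do rewrite scaler_suml.
  rewrite exchange_big /= big_seq_cond [RHS]big_seq_cond; apply: eq_bigr => t /andP[te _].
  rewrite [genpart _ _ _](@hsum_part_sch d); last first.
    by apply: leq_trans e_d; rewrite (big_rem t te) leq_addr.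
  rewrite scaler_sumr; apply: eq_bigr => a _.
  by rewrite -mpolyC_nat mul_mpolyC scalerA.
by apply: eq_bigr => t _; rewrite (mcoeff_part_schur _ la_d).
Qed.

(** * Constituents with a long first row *)

(** The coefficient of the monomial with exponents [a] is [r a] plus multiples of [r b] with
    [rowwt b < rowwt a]. Only partitions are concerned, as [sch] vanishes at the other shapes. *)
Lemma sch_free d (r r' : shape d -> rat) :
  \sum_a r a *: sch a (vars d.+1) = \sum_a r' a *: sch a (vars d.+1) ->
  forall a, is_part a -> r a = r' a.
Proof.
move=> E a; move: {2}(rowwt a) (erefl (rowwt a)) => w.
elim/ltn_ind: w a => w IH a wE pa.
have co (q : shape d -> rat) :
    (\sum_b q b *: sch b (vars d.+1))@_a =
    q a + \sum_(b | b != a) q b * (kostka b (rev (a : 'X_{1..d.+1})))%:R.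
  have mE b : (sch b (vars d.+1))@_a = (kostka b (rev (a : 'X_{1..d.+1})))%:R.
    rewrite /vars -map_rev mcoeff_sch ?rev_uniq ?enum_uniq //.
    have -> : [forall j, (j \notin rev (enum 'I_d.+1)) ==> ((a : 'X_{1..d.+1}) j == 0%N)].
      by apply/forallP => j; rewrite mem_rev mem_enum.
    congr (kostka _ _)%:R; rewrite map_rev; congr rev.
    rewrite -[RHS](mkseq_nth 0%N) /mkseq size_tuple -val_enum_ord -map_comp.
    by apply: eq_map => i /=; rewrite (mnm_nth 0%N).
  rewrite raddf_sum (bigD1 a) //= mcoeffZ mE kostka_shape // mulr1; congr (_ + _).
  by apply: eq_bigr => b _; rewrite mcoeffZ mE.
have := congr1 (mcoeff a) E; rewrite !co.
rewrite [X in _ + X](_ : _ = \sum_(b | b != a) r' b * (kostka b (rev (a : 'X_{1..d.+1})))%:R).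
  exact: addIr.
apply: eq_bigr => b ba; have [->|kb] := eqVneq (kostka b (rev (a : 'X_{1..d.+1}))) 0%N.
  by rewrite !mulr0.
congr (_ * _); apply: (IH (rowwt b)) => //; last exact: kostka_is_part kb.
by rewrite -wE; exact: kostka_shape_lt kb ba.
Qed.

Section PairsCoefficients.
Variables (d : nat) (c : shape d -> rat) (b : shape d).
Hypothesis schE : forall N, \sum_a c a *: sch a (vars N) = sch b (pairs (vars N)).

(** Frees the hypothesis from [vars], so that one letter can be the indeterminate of a polynomial
    ring over the others. *)
Lemma sch_pairs_ring (S : comNzRingType) (f : {rmorphism rat -> S}) (ys : seq S) :
  \sum_a f (c a) * sch a ys = sch b (pairs ys).
Proof.
pose h (i : 'I_(size (rev ys))) := (rev ys)`_i.
have hE : [seq mmap f h p | p <- vars (size (rev ys))] = ys.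
  rewrite /vars map_rev -map_comp -[RHS]revK; congr rev.
  rewrite -[RHS](mkseq_nth 0) /mkseq -val_enum_ord -map_comp.
  by apply: eq_map => i /=; rewrite mmapX mmap1U.
have := congr1 (mmap f h) (schE (size (rev ys))).
rewrite rmorph_skew map_pairs; last by move=> x y; rewrite rmorphM.
rewrite hE -/(sch b (pairs ys)) => <-; rewrite rmorph_sum; apply: eq_bigr => a _ /=.
by rewrite mmapZ rmorph_skew hE.
Qed.

(** The coefficient of x^e on both sides, for the alphabet x + X. On the right, [m] is what the
    letter x^2 leaves of [b], and [r] is the part filled with the products x y: the exponents are 2
    |b / m| and |r|. *)
Lemma sch_pairs_coef N e :
  \sum_(r : shape d) (\sum_(k | hstrip k r && (mdeg k == mdeg r + e)%N) c k) *: sch r (vars N) =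
  \sum_(m | hstrip b m) \sum_(r : shape d | (2 * (mdeg b - mdeg m) + mdeg r == e)%N)
     skew m r (pairs (vars N)) * sch r (vars N).
Proof.
set xs := vars N; pose f : {rmorphism rat -> {poly {mpoly rat[N]}}} := polyC \o @mpolyC N rat.
have coXC n (q : {mpoly rat[N]}) : ('X^n * q%:P)`_e = if n == e then q else 0.
  by rewrite mulrC mul_polyC coefZ coefXn eq_sym; case: eqP; rewrite ?mulr1 ?mulr0.
have schC (r : shape d) : sch r (map polyC xs) = (sch r xs)%:P by rewrite /sch rmorph_skew.
have := congr1 (fun p : {poly {mpoly rat[N]}} => p`_e) (sch_pairs_ring f ('X :: map polyC xs)).
rewrite /= => E; transitivity ((\sum_a f (c a) * sch a ('X :: map polyC xs))`_e).
  rewrite coef_sum.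
  under eq_bigr => r _ do rewrite scaler_suml.
  rewrite (exchange_big_dep xpredT) //=; apply: eq_bigr => k _.
  rewrite coefCM /sch skew_cons coef_sum mulr_sumr [LHS]big_mkcondr /=.
  apply: eq_bigr => r kr; have rk := hstrip_mdeg kr.
  rewrite -!/(sch _ _) schC coXC mul_mpolyC.
  have -> : (mdeg k - mdeg r == e)%N = (mdeg k == mdeg r + e)%N by apply/eqP/eqP; lia.
  by case: eqP; rewrite ?scaler0.
rewrite E /= /sch skew_cons coef_sum; apply: eq_bigr => m bm.
rewrite skew_cat mulr_sumr coef_sum [RHS]big_mkcond; apply: eq_bigr => r _ /=.
rewrite -map_pairs; last exact: polyCM.
rewrite -rmorph_skew -/(sch r _) sch_homog schC -expr2 -exprM mulrCA [X in _ * X]mulrA.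
rewrite -exprD mulrCA -polyCM coXC.
by case: eqP.
Qed.

End PairsCoefficients.

Section Tail.
Variable d : nat.
Implicit Types a k : shape d.

Definition tail a : shape d := mkshape d (fun i => rowlen a i.+1).

Let sum_tail a : (\sum_(i < d.+1) rowlen a i.+1 + rowlen a 0 = mdeg a)%N.
Proof.
by rewrite mdeg_rowlen sum_ord_recl addnC big_ord_recr /= [rowlen a d.+1]rowlen_ge // addn0.
Qed.

Let sum_tail_le a : (\sum_(i < d.+1) rowlen a i.+1 <= d)%N.
Proof. by apply: leq_trans (mdeg_shape a); rewrite -sum_tail leq_addr. Qed.

Lemma rowlen_tail a i : rowlen (tail a) i = rowlen a i.+1.
Proof. by apply: rowlen_mk => // j dj; rewrite rowlen_ge // leqW. Qed.

Lemma mdeg_tail a : (mdeg (tail a) + rowlen a 0 = mdeg a)%N.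
Proof. by rewrite mdeg_mk // sum_tail. Qed.

Lemma hstrip_tail a : is_part a -> hstrip a (tail a).
Proof. by move/is_partP=> pa; apply/hstripP => i; rewrite rowlen_tail leqnn pa. Qed.

(** A horizontal strip has at most one box in each column, so [tail a] is the least that removing
    one can leave. *)
Lemma tail_le a k : hstrip a k -> (mdeg (tail a) <= mdeg k)%N.
Proof.
by move/hstripP=> ak; apply: leq_mdeg => i; rewrite rowlen_tail; case/andP: (ak i).
Qed.

Lemma tail_eq a k : hstrip a k -> mdeg k = mdeg (tail a) -> k = tail a.
Proof.
move/hstripP=> ak E; apply: eq_shape_mdeg => // i.
by rewrite rowlen_tail; case/andP: (ak i).
Qed.

(** The rows of [k] below the first fit into those of [a], so at equal size any difference lengthens
    the first row. This is the triangularity by which the coefficients are determined. *)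
Lemma hstrip_tail_lt a k : hstrip k (tail a) -> mdeg k = mdeg a -> k != a ->
  (rowlen a 0 < rowlen k 0)%N.
Proof.
move/hstripP=> ka E; apply: contraR; rewrite -leqNgt => le.
apply/eqP/esym/eq_shape_mdeg => // -[//|i].
by have := ka i; rewrite rowlen_tail => /andP[].
Qed.

End Tail.

Section TopCoefficients.
Variables (d : nat) (c : shape d -> rat) (nu : shape d).
Hypothesis schE : forall N, \sum_a c a *: sch a (vars N) = sch nu (pairs (vars N)).
Hypotheses (nu_part : is_part nu) (nu_d : (2 * mdeg nu <= d)%N).
Implicit Types k m r a : shape d.

Let n := mdeg nu.
Let nu0 := rowlen nu 0.
Let t := tail nu.
Let tE : (mdeg t + nu0 = n)%N. Proof. exact: mdeg_tail. Qed.

(** In each term |m| - |r| = 2n - e - |m|, and |m| is at least |t| = n - nu_1. A negative difference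
    kills the term and 0 forces r = m; hence nothing survives beyond e = n + nu_1. *)
Let rhs e N : {mpoly rat[N]} :=
  \sum_(m | hstrip nu m) \sum_(r : shape d | (2 * (mdeg nu - mdeg m) + mdeg r == e)%N)
     skew m r (pairs (vars N)) * sch r (vars N).

Let rhs_term e N m : hstrip nu m -> (2 * n < e + mdeg m)%N ->
  \sum_(r : shape d | (2 * (mdeg nu - mdeg m) + mdeg r == e)%N)
     skew m r (pairs (vars N)) * sch r (vars N) = 0.
Proof.
move=> nm lt; apply: big1 => r /eqP re; rewrite skew_lt ?mul0r //.
by have := hstrip_mdeg nm; move: lt re; rewrite /n; lia.
Qed.

Let rhs_diag e N m : hstrip nu m -> (2 * n = e + mdeg m)%N ->
  \sum_(r : shape d | (2 * (mdeg nu - mdeg m) + mdeg r == e)%N)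
     skew m r (pairs (vars N)) * sch r (vars N) = sch m (vars N).
Proof.
move=> nm E; have pm := hstrip_partr nm; have le := hstrip_mdeg nm.
rewrite (bigD1 m) /=; last by apply/eqP; move: E; rewrite /n; lia.
rewrite skew_eq_mdeg // eqxx mul1r big1 ?addr0 // => r /andP[/eqP re rm].
rewrite skew_eq_mdeg // ?[m == r]eq_sym ?(negbTE rm) ?mul0r //.
by move: E re; rewrite /n; lia.
Qed.

Let rhs_gt e N : (n + nu0 < e)%N -> rhs e N = 0.
Proof.
move=> lt; apply: big1 => m nm; apply: rhs_term => //.
by have := tail_le nm; move: tE lt; rewrite -/t; lia.
Qed.

Let rhs_top N : rhs (n + nu0) N = sch t (vars N).
Proof.
rewrite /rhs (bigD1 t) /=; last exact: hstrip_tail.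
rewrite rhs_diag ?hstrip_tail //; last by move: tE; lia.
rewrite big1 ?addr0 // => m /andP[nm mt]; apply: rhs_term => //.
have := tail_le nm; rewrite leq_eqVlt => /predU1P[E|]; last by move: tE; rewrite -/t; lia.
by rewrite (tail_eq nm) ?eqxx in mt.
Qed.

(** Now |m| - |r| = |t| + 1 - |m|. Either |m| = |t| + 1 and r = m, or m = t and one box is left,
    which contributes h_2 by [skew_mdegS]; Pieri's rule then expands h_2 s_r. *)
Let rhs_next e N : (e.+1 = n + nu0)%N ->
  rhs e N = \sum_(m | hstrip nu m && (mdeg m == (mdeg t).+1)) sch m (vars N) +
            \sum_(r | hstrip t r && (mdeg t == (mdeg r).+1))
               \sum_(a | hstrip a r && (mdeg a == mdeg r + 2)%N) sch a (vars N).
Proof.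
move=> eE; have pt : is_part t := hstrip_partr (hstrip_tail nu_part).
rewrite /rhs (bigD1 t) /=; last exact: hstrip_tail.
rewrite addrC; congr (_ + _).
  rewrite [RHS]big_mkcondr [RHS](bigD1 t) /=; last exact: hstrip_tail.
  rewrite ifF ?add0r; last by rewrite ltn_eqF.
  apply: eq_bigr => m /andP[nm mt]; case: eqP => [E|E].
    by apply: rhs_diag => //; move: tE; lia.
  apply: rhs_term => //; have := tail_le nm; rewrite leq_eqVlt => /predU1P[E'|].
    by rewrite (tail_eq nm) ?eqxx in mt.
  by move: tE; rewrite -/t; lia.
rewrite [RHS]big_mkcond [LHS]big_mkcond; apply: eq_bigr => r _.
have -> : ((2 * (mdeg nu - mdeg t) + mdeg r)%N == e) = (mdeg t == (mdeg r).+1).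
  by apply/eqP/eqP; move: tE eE; rewrite /n; lia.
rewrite andbC; case: eqP => //= tr; rewrite skew_mdegS //.
case: ifP => [rt|_]; last by rewrite !mul0r.
rewrite mul1r sum_pairs pieri //.
by have := hstrip_mdeg (hstrip_tail nu_part); rewrite -/t; lia.
Qed.

Let coef_eq e (R : shape d -> rat) :
  rhs e d.+1 = \sum_r R r *: sch r (vars d.+1) ->
  forall r, is_part r ->
  \sum_(k | hstrip k r && (mdeg k == mdeg r + e)%N) c k = R r.
Proof.
move=> E; apply: sch_free; rewrite -E; exact: (sch_pairs_coef schE).
Qed.

Let coef_tail a : is_part a ->
  \sum_(k | hstrip k (tail a) && (mdeg k == mdeg (tail a) + rowlen a 0)%N) c k =
  c a + \sum_(k | [&& hstrip k (tail a), mdeg k == mdeg a & (rowlen a 0 < rowlen k 0)%N]) c k.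
Proof.
move=> pa; rewrite mdeg_tail (bigD1 a) /=; last by rewrite hstrip_tail // eqxx.
congr (_ + _); apply: eq_bigl => k; rewrite -andbA; case: (boolP (hstrip k _)) => //= ka.
case: eqP => //= E; apply/idP/idP => [|lt]; first exact: hstrip_tail_lt ka E.
by apply: contraL lt => /eqP->; rewrite ltnn.
Qed.

Let coef_tail0 a : is_part a ->
  (forall k, hstrip k (tail a) -> mdeg k = mdeg a -> (rowlen a 0 < rowlen k 0)%N -> c k = 0) ->
  \sum_(k | hstrip k (tail a) && (mdeg k == mdeg (tail a) + rowlen a 0)%N) c k = c a.
Proof.
move=> pa z; rewrite coef_tail // [X in _ + X]big1 ?addr0 // => k /and3P[kt /eqP ka lt].
exact: z.
Qed.

Lemma coef_gt a : is_part a -> (n + nu0 < rowlen a 0)%N -> c a = 0.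
Proof.
(* First rows have length at most [d], so the induction can go downwards from the longest. *)
move: {2}(d - rowlen a 0)%N (erefl (d - rowlen a 0)%N) => w.
elim/ltn_ind: w a => w IH a wE pa lt.
rewrite -coef_tail0 // => [|k kt _ lt'].
  apply: (coef_eq (R := fun=> 0)); last exact: hstrip_partr (hstrip_tail pa).
  by rewrite rhs_gt // big1 // => r _; rewrite scale0r.
have pk := hstrip_partl kt; apply: (IH (d - rowlen k 0)%N) => //; last exact: ltn_trans lt'.
by have := mdeg_tail k; have := mdeg_shape k; lia.
Qed.

Lemma coef_top a : is_part a -> rowlen a 0 = (n + nu0)%N -> c a = (tail a == t)%:R.
Proof.
move=> pa a0.
rewrite -coef_tail0 // => [|k kt _ lt'].
  apply: (coef_eq (R := fun r => (r == t)%:R)); last exact: hstrip_partr (hstrip_tail pa).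
  rewrite a0 rhs_top (bigD1 t) //= eqxx scale1r big1 ?addr0 // => r /negbTE->.
  by rewrite scale0r.
by apply: coef_gt; rewrite -?a0 // (hstrip_partl kt).
Qed.

Lemma coef_next a : is_part a -> mdeg a = (2 * n)%N -> (rowlen a 0).+1 = (n + nu0)%N ->
  (rowlen nu 1 < nu0)%N ->
  c a = #|[set r | [&& hstrip t r, mdeg t == (mdeg r).+1 & hstrip (tail a) r]]|%:R.
Proof.
move=> pa an a0 nu10; set s := tail a; set A := [set r | _].
have sE : (mdeg s = (mdeg t).+1)%N by have := mdeg_tail a; rewrite -/s; move: tE; lia.
have ps : is_part s := hstrip_partr (hstrip_tail pa).
have H := @coef_eq (rowlen a 0) (fun m => (hstrip nu m && (mdeg m == (mdeg t).+1))%:R +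
   \sum_(r | [&& hstrip t r, mdeg t == (mdeg r).+1, hstrip m r & (mdeg m == mdeg r + 2)%N]) 1) _ s ps.
move: H; rewrite coef_tail // -/s.
have -> : \sum_(r | [&& hstrip t r, mdeg t == (mdeg r).+1, hstrip s r &
             (mdeg s == mdeg r + 2)%N]) 1 = #|A|%:R :> rat.
  rewrite -sum1_card natr_sum; apply: eq_bigl => r; rewrite !inE.
  case: (hstrip t r) => //=; case: eqP => //= tr; rewrite sE tr addn2 eqxx andbT //.
(* The rows of bar nu, which becomes the shape [nb]. *)
pose f i := (if i is 0 then n + nu0 else rowlen nu i)%N.
pose nb : shape d := mkshape d f.
have sum_nb : (\sum_(i < d.+1) f i = 2 * n)%N.
  rewrite sum_ord_recl /f; move: tE; rewrite /n -[in RHS](mdeg_tail nu) -/nu0.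
  have := mdeg_rowlen nu; rewrite sum_ord_recl -/nu0; lia.
have nbE i : rowlen nb i = if i is 0 then (n + nu0)%N else rowlen nu i.
  by apply: (rowlen_mk (f := f)) => [|[//|j] dj]; [rewrite sum_nb | rewrite /f rowlen_ge].
have nbn : mdeg nb = (2 * n)%N by rewrite mdeg_mk sum_nb.
have pnb : is_part nb.
  apply/is_partP => i; rewrite !nbE; case: i => [|i]; last by move/is_partP: nu_part; apply.
  by move/is_partP: nu_part => /(_ 0%N); rewrite -/nu0; lia.
have tnb : tail nb = t by apply: shapeP => i; rewrite !rowlen_tail nbE.
(* A longer first row has length n + nu_1, where [coef_top] leaves only bar nu, or more, where
   [coef_gt] leaves nothing. *)
have -> : \sum_(k | [&& hstrip k s, mdeg k == mdeg a & (rowlen a 0 < rowlen k 0)%N]) c k =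
          (hstrip nb s)%:R.
  have zero k : hstrip k s -> (rowlen a 0 < rowlen k 0)%N -> mdeg k = mdeg a -> k != nb -> c k = 0.
    move=> ks; have pk := hstrip_partl ks; rewrite leq_eqVlt => /predU1P[E|lt] kn knb.
      rewrite coef_top //; last by rewrite -E a0.
      case: eqP => // tk; case/negP: knb; apply/eqP/shapeP => -[|i].
        by rewrite nbE -E a0.
      by rewrite -!rowlen_tail tk tnb.
    by apply: coef_gt => //; rewrite -a0.
  have [nbs|nbs] := boolP (hstrip nb s).
    rewrite (bigD1 nb) /=; last by rewrite nbs nbn an eqxx nbE; lia.
    rewrite coef_top ?nbE // tnb eqxx big1 ?addr0 // => k /andP[/and3P[ks /eqP ka lt] knb].
    exact: zero.
  apply: big1 => k /and3P[ks /eqP ka lt]; apply: zero => //.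
  by apply: contraNneq nbs => <-.
(* The two conditions differ only in the bound on the first row of [s]. If bar nu / s is a strip,
   then [s] is [t] with one more box, so s_1 <= nu_2 + 1 <= nu_1. *)
have -> : hstrip nb s = hstrip nu s.
  apply/hstripP/hstripP => H i; move: (H i); rewrite !nbE; case: i => [|i] //=.
    move=> /andP[nus _]; rewrite nus /=.
    have le j : (rowlen t j <= rowlen s j)%N.
      by rewrite (rowlen_tail nu j); have := H j; rewrite nbE => /andP[].
    have : (rowlen s 0 <= (rowlen t 0).+1)%N.
      move: sE; rewrite !mdeg_rowlen !sum_ord_recl.
      have : (\sum_(i < d) rowlen t i.+1 <= \sum_(i < d) rowlen s i.+1)%N by apply: leq_sum.
      by lia.
    by rewrite (rowlen_tail nu 0) -/nu0; lia.
  by rewrite -/nu0; move=> /andP[-> /=]; lia.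
rewrite sE eqxx andbT => H.
(* The contribution of bar nu cancels against that of m = s. *)
apply: (addIr (hstrip nu s)%:R); rewrite [RHS]addrC; apply: H.
rewrite rhs_next // [RHS](eq_bigr _ (fun m _ => scalerDl _ _ _)) big_split /=.
congr (_ + _).
  rewrite big_mkcond; apply: eq_bigr => m _; case: ifP => _; by rewrite ?scale1r ?scale0r.
under [RHS]eq_bigr => m _ do rewrite scaler_suml.
rewrite [RHS](exchange_big_dep (fun r => hstrip t r && (mdeg t == (mdeg r).+1))) /=; last first.
  by move=> m r _ /and4P[-> ->].
apply: eq_bigr => r /andP[tr trd]; apply: eq_big => [m|m _]; last by rewrite scale1r.
by rewrite tr trd.
Qed.

End TopCoefficients.

(** * Counting the pairs (a, b) *)

Lemma two_units m (h : nat -> nat) : (\sum_(i < m) h i = 2)%N ->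
  exists a b, [/\ (b <= a)%N, (a < m)%N & forall i, (i < m)%N -> h i = ((i == a) + (i == b))%N].
Proof.
move=> h2; have [a ha] : exists a : 'I_m, h a != 0%N.
  have : (\sum_(i < m) h i != 0)%N by rewrite h2.
  by rewrite sum_nat_eq0 negb_forall => /existsP[a]; exists a.
have /eqP/sum_nat_eq1[b [_ hb hb']] : (\sum_(i < m) (h i - (i == a :> nat)) = 1)%N.
  move: h2; rewrite (bigD1 a) //= => h2'; rewrite (bigD1 a) //= eqxx.
  rewrite [X in (_ + X = 1)%N](eq_bigr (fun i : 'I_m => h i)); first by move: ha h2'; lia.
  by move=> i; rewrite -val_eqE /= => /negbTE->; rewrite subn0.
have hE i : (i < m)%N -> h i = ((i == a) + (i == b))%N.
  move=> im; have [E|ib] := eqVneq (Ordinal im) b.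
    by move: hb; rewrite -E /= eqxx; case: eqP => [->|_]; move: ha; lia.
  have := hb' (Ordinal im) ib isT; rewrite /= -val_eqE /= in ib *.
  by rewrite (negbTE ib); case: eqP => [->|_]; move: ha; lia.
case: (leqP b a) => ab; [by exists a, b | exists b, a; split=> // [|i /hE ->]].
  exact: ltnW.
exact: addnC.
Qed.

(** The larger index is the last place where the sum is nonzero. *)
Lemma units_inj a b a' b' : (1 < b)%N -> (b <= a)%N -> (1 < b')%N -> (b' <= a')%N ->
  (forall i, (1 < i)%N -> (i == a) + (i == b) = (i == a') + (i == b'))%N ->
  a = a' /\ b = b'.
Proof.
move=> b1 ba b1' ba' H; case: (ltngtP a a') => aa.
- by have := H a' (leq_trans b1' ba'); rewrite eqxx (gtn_eqF aa) (gtn_eqF (leq_ltn_trans ba aa)).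
- by have := H a (leq_trans b1 ba); rewrite eqxx (gtn_eqF aa) (gtn_eqF (leq_ltn_trans ba' aa)).
split=> //; have := H b b1; rewrite aa eqxx => /addnI.
by case: (b =P b').
Qed.

Section Rows.
Implicit Types s : seq nat.

Lemma coeff_eps i j : coeff i (eps j) = (j == i)%:R :> int.
Proof. by rewrite coeffU mul1r. Qed.

Lemma coeff_rows s i : coeff i (rows s) = (part s i)%:Z.
Proof.
rewrite /rows raddf_sum /=.
under eq_bigr => j _ do rewrite coeffMn coeff_eps.
case: (boolP (0 < i < (size s).+1)%N) => [/andP[i0 il]|out].
  rewrite (bigD1_seq i) ?mem_index_iota ?i0 ?iota_uniq //= eqxx big1 ?addr0.
    by rewrite mulr1n natz.
  by move=> j /negbTE->; rewrite mul0rn.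
rewrite big_nat_cond big1.
  case: i out => [|i]; first by [].
  by rewrite /= ltnS -leqNgt => /(nth_default 0%N) E; rewrite /part /= E.
move=> j /andP[jl _]; case: eqP => [E|_]; last by rewrite mul0rn.
by move: out; rewrite -E jl.
Qed.

Lemma coeff_bar (nu : intpart) i : coeff i (bar nu) = (part nu i + sumn nu * (i == 1%N))%:Z.
Proof.
rewrite /bar coeffD coeffMn coeff_eps coeff_rows eq_sym PoszD; congr (_ + _).
by case: eqP => _; rewrite ?mul0rn ?muln0 ?muln1 ?mulr1n ?natz.
Qed.

(** The subtracted unit vectors are moved to the other side, so that the equation is one between
    natural numbers. *)
Lemma rowsP (nu la : intpart) x a b :
  reflect (forall i, part la i + (i == 1) + (i == x) =
                     part nu i + sumn nu * (i == 1) + (i == a) + (i == b))%N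
          (rows la == bar nu - eps 1 - eps x + eps a + eps b).
Proof.
have coE i : coeff i (bar nu - eps 1 - eps x + eps a + eps b) =
    (part nu i + sumn nu * (i == 1))%N%:Z - (i == 1)%:R - (i == x)%:R + (i == a)%:R + (i == b)%:R.
  by rewrite !(coeff_bar, coeffD, coeffN) !coeff_eps ![_ == i]eq_sym.
apply: (iffP (freeg_eqP _ _)) => H i.
  by have /= := H i; rewrite coE coeff_rows; lia.
by rewrite /= coE coeff_rows; have := H i; lia.
Qed.

Lemma removable_bar (nu : intpart) x : (1 < x)%N ->
  removable (bar nu - eps 1) x = (part nu x.+1 < part nu x)%N.
Proof.
move=> x1; rewrite /removable !(coeff_bar, coeffD, coeffN) !coeff_eps.
by case: x x1 => [|[|x]] //= _; rewrite !muln0 !addn0 !subr0 ltz_nat.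
Qed.

Lemma part_gt0 (s : seq nat) i : (0 < part s i)%N -> (i < (size s).+1)%N.
Proof.
case: i => // i p0; rewrite ltnS ltnNge; apply/negP => /(nth_default 0%N) E.
by rewrite /part /= E in p0.
Qed.

End Rows.

Section Bijection.
Variables (nu la : intpart) (d : nat).
Hypotheses (nu_d : (sumn nu <= d)%N) (la_d : (sumn la <= d)%N).
Hypotheses (la_2n : sumn la = (2 * sumn nu)%N) (nu1 : (0 < part nu 1)%N)
  (la1 : part la 1 = (sumn nu + part nu 1 - 1)%N).

Let nu_part : is_intpart nu. Proof. by case: nu. Qed.
Let la_part : is_intpart la. Proof. by case: la. Qed.

Let tnu : shape d := tail (shape_of d nu).
Let tla : shape d := tail (shape_of d la).

(** The shift is 2 because [part] numbers rows from 1 and the first row is dropped. *)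
Let tnuE i : rowlen tnu i = part nu i.+2.
Proof. by rewrite rowlen_tail rowlen_shape_of. Qed.

Let tlaE i : rowlen tla i = part la i.+2.
Proof. by rewrite rowlen_tail rowlen_shape_of. Qed.

Let nu_anti i : (0 < i)%N -> (part nu i.+1 <= part nu i)%N.
Proof. by case: i => // i _; exact: (intpart_nth_anti nu_part (leqnSn i)). Qed.

Let la_anti i : (0 < i)%N -> (part la i.+1 <= part la i)%N.
Proof. by case: i => // i _; exact: (intpart_nth_anti la_part (leqnSn i)). Qed.

(** Row 1 is settled by [la1], as x, a and b lie below it. *)
Let obtainedP x a b : (1 < x)%N -> (1 < b)%N -> (b <= a)%N ->
  reflect [/\ (part nu x.+1 < part nu x)%N, a != b -> part la a != part la b &
     forall i, (1 < i)%N -> (part la i + (i == x) = part nu i + (i == a) + (i == b))%N]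
  (obtained nu la x a b).
Proof.
move=> x1 b1 ba; rewrite /obtained x1 b1 ba removable_bar //=.
apply: (iffP and3P) => [[r /implyP ab /rowsP H]|[r ab H]]; split=> //.
- by move=> i i1; have := H i; rewrite (gtn_eqF i1) muln0 !addn0.
- exact/implyP.
apply/rowsP => -[|[|i]]; last by have := H i.+2 isT; rewrite /= muln0 !addn0.
  by change (part la 0) with 0%N; change (part nu 0) with 0%N; rewrite /= muln0; lia.
by rewrite la1 /= muln1; lia.
Qed.

Definition rests := [set r | [&& hstrip tnu r, mdeg tnu == (mdeg r).+1 & hstrip tla r]].

Let core (a b : nat) : shape d :=
  mkshape d (fun i => part la i.+2 - (i.+2 == a) - (i.+2 == b))%N.

Let core_row a b i : rowlen (core a b) i = (part la i.+2 - (i.+2 == a) - (i.+2 == b))%N.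
Proof.
apply: rowlen_mk => [|j dj]; last by rewrite -tlaE rowlen_ge.
apply: leq_trans (mdeg_shape tla); rewrite mdeg_rowlen; apply: leq_sum => j _.
by rewrite tlaE -subnDA leq_subr.
Qed.

Let IsetP (a b : 'I_(size la).+1) :
  reflect (exists x, [/\ (1 < x)%N, (1 < b)%N, (b <= a)%N & obtained nu la x a b])
          ((a, b) \in Iset nu la).
Proof.
rewrite inE; apply: (iffP existsP) => /= [[x H]|[x [x1 b1 ba H]]].
  by exists x; case/and5P: (H) => -> _ -> -> _.
have xnu : (x < (size nu).+1)%N.
  by apply: part_gt0; case/(obtainedP x1 b1 ba): H => + _ _; apply: leq_ltn_trans.
by exists (Ordinal xnu).
Qed.

Let core_Iset (a b : 'I_(size la).+1) : (a, b) \in Iset nu la ->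
  (forall i, part la i.+2 = rowlen (core a b) i + (i.+2 == a) + (i.+2 == b))%N
  /\ core a b \in rests.
Proof.
case/IsetP=> x [x1 b1 ba] /(obtainedP x1 b1 ba)[rem neq H].
(* Row [x] of [nu] has a box to lose, so the truncated subtractions in [core] are exact. *)
have le i : ((i.+2 == a) + (i.+2 == b) <= part la i.+2)%N.
  have := H i.+2 isT; have [->|] := eqVneq i.+2 x; last by lia.
  by move: rem; lia.
have laE i : (part la i.+2 = rowlen (core a b) i + (i.+2 == a) + (i.+2 == b))%N.
  by rewrite core_row; have := le i; lia.
have nuE i : (part nu i.+2 = rowlen (core a b) i + (i.+2 == x))%N.
  by have := H i.+2 isT; rewrite laE; lia.
have nuc i : (part nu i.+3 <= rowlen (core a b) i)%N.
  have := nu_anti (ltn0Sn i.+1); have := nuE i.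
  by have [E|_] := eqVneq i.+2 x; [move: rem; rewrite -E | ]; lia.
split=> //; rewrite inE; apply/and3P; split.
- by apply/hstripP => i; rewrite !tnuE nuc nuE leq_addr.
- have xd : (x - 2 < d.+1)%N.
    have xnu : (x < (size nu).+1)%N by apply: part_gt0; apply: leq_ltn_trans rem.
    have := leq_trans (size_le_sumn nu_part) nu_d; lia.
  have x_sum : (\sum_(i < d.+1) (i.+2 == x) = 1)%N.
    rewrite (bigD1 (Ordinal xd)) //= big1 => [|i]; first by lia.
    by rewrite -val_eqE /=; lia.
  rewrite !mdeg_rowlen; under eq_bigr => i _ do rewrite tnuE nuE.
  by rewrite big_split /= x_sum addn1.
apply/hstripP => i; rewrite !tlaE; apply/andP; split; last by rewrite laE -addnA leq_addr.
have := la_anti (ltn0Sn i.+1); have := nuc i; have := nuE i.+1; have := laE i; have := laE i.+1.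
(* Only a = b + 1 could put both boxes in one column, and there la_a and la_b would be equal. *)
have [ia|] := eqVneq i.+3 (a : nat); have [ib|] := eqVneq i.+2 (b : nat); try lia.
by move: neq; rewrite -ia -ib; lia.
Qed.

Let core_inj : {in Iset nu la &, injective (fun ab : 'I_(size la).+1 * 'I_(size la).+1 => core ab.1 ab.2)}.
Proof.
move=> [a b] [a' b'] abI abI' /= E.
have [laE _] := core_Iset abI; have [laE' _] := core_Iset abI'.
have [x [_ b1 ba _]] := IsetP _ _ abI; have [x' [_ b1' ba' _]] := IsetP _ _ abI'.
have H i : (1 < i)%N -> ((i == a) + (i == b) = (i == a') + (i == b'))%N.
  case: i => [|[|i]] // _; apply/eqP; rewrite -(eqn_add2l (rowlen (core a b) i)) !addnA -laE.
  by rewrite E -laE'.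
by have [/val_inj -> /val_inj ->] := units_inj b1 ba b1' ba' H.
Qed.

Let core_onto r : r \in rests -> exists2 ab, ab \in Iset nu la & r = core ab.1 ab.2.
Proof.
rewrite inE => /and3P[tr /eqP rE lr].
have tla_r : (mdeg tla = mdeg r + 2)%N.
  have := mdeg_tail (shape_of d la); have := mdeg_tail (shape_of d nu).
  rewrite !mdeg_shape_of // !rowlen_shape_of // -/tla -/tnu.
  by move: la1 nu1; rewrite /part /=; lia.
move/hstripP: tr => tr; move/hstripP: lr => lr.
have [a0 [b0 [ba ad hab]]] : exists a b, [/\ (b <= a)%N, (a < d.+1)%N &
    forall i, (i < d.+1)%N -> (rowlen tla i - rowlen r i)%N = ((i == a) + (i == b))%N].
  apply: two_units; apply/eqP; rewrite -(eqn_add2l (mdeg r)) -tla_r !mdeg_rowlen -big_split /=.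
  by apply/eqP/eq_bigr => i _; case/andP: (lr i) => _; exact: subnKC.
have /eqP/sum_nat_eq1[x0 [_ hx hx']] : (\sum_(i < d.+1) (rowlen tnu i - rowlen r i) = 1)%N.
  apply/eqP; rewrite -(eqn_add2l (mdeg r)) addn1 -rE !mdeg_rowlen -big_split /=.
  by apply/eqP/eq_bigr => i _; case/andP: (tr i) => _; exact: subnKC.
have laE i : (part la i.+2 = rowlen r i + (i == a0) + (i == b0))%N.
  have := lr i; rewrite -tlaE; case: (ltnP i d.+1) => [id|di]; first by have := hab i id; lia.
  by rewrite !rowlen_ge //; lia.
have nuE i : (part nu i.+2 = rowlen r i + (i == x0))%N.
  have := tr i; rewrite -tnuE; case: (ltnP i d.+1) => [id|di]; last first.
    by rewrite !rowlen_ge //; have := ltn_ord x0; lia.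
  have [E|ne] := eqVneq (Ordinal id) x0; first by move: hx; rewrite -E /= eqxx; lia.
  have := hx' (Ordinal id) ne isT; move: ne; rewrite -val_eqE /= => /negbTE->; lia.
have aP : (a0.+2 < (size la).+1)%N by apply: part_gt0; rewrite laE eqxx; lia.
have bP : (b0.+2 < (size la).+1)%N by apply: part_gt0; rewrite laE eqxx; lia.
exists (Ordinal aP, Ordinal bP); last first.
  apply: shapeP => i; rewrite core_row /= laE; lia.
apply/IsetP; exists x0.+2; split=> //; apply/obtainedP => //; split.
- by have := tr x0; have := nuE x0; rewrite !tnuE eqxx; lia.
(* For a > b the strip condition gives la_a <= la_(b+1) <= r_b < la_b. *)
- rewrite /= => ab; apply/eqP => E; have := lr b0; rewrite !tlaE => /andP[le _].
  have := @is_part_anti d tla b0.+1 a0; rewrite !tlaE => anti.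
  have {}anti := anti (hstrip_partr (hstrip_tail (is_part_shape_of la_part la_d))) ltac:(lia).
  by move: le; have := laE b0; rewrite eqxx; lia.
by case=> [|[|i]] // _; rewrite laE nuE /=; lia.
Qed.

Lemma card_rests : #|rests| = #|Iset nu la|.
Proof.
rewrite -(card_in_imset core_inj); apply: eq_card => r; apply/idP/imsetP.
  by case/core_onto=> ab abI ->; exists ab.
by case=> -[a b] /core_Iset[_ ?] ->.
Qed.

(** Row [x] is shorter in [la] than in [nu], so every way of obtaining [la] removes its box from row
    [x]; the two added boxes are then determined. *)
Lemma card_Iset1 x a b : (1 < x)%N -> (1 < a)%N -> (1 < b)%N -> x <> a -> x <> b ->
  (a <> b -> part nu a <> part nu b) ->
  rows la = bar nu - eps 1 - eps x + eps a + eps b -> #|Iset nu la| = 1%N.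
Proof.
move=> x1; wlog ba : a b / (b <= a)%N => [IH|].
  case: (leqP b a) => [|/ltnW] ba a1 b1 xa xb ab rE; first exact: (IH a b).
  by apply: (IH b a) => //; [move=> /nesym/ab/nesym | rewrite rE addrAC].
move=> a1 b1 xa xb ab /eqP/rowsP H.
have {}H i : (1 < i)%N -> (part la i + (i == x) = part nu i + (i == a) + (i == b))%N.
  by move=> i1; have := H i; rewrite (gtn_eqF i1) muln0 !addn0.
have aP : (a < (size la).+1)%N by apply: part_gt0; have := H a a1; lia.
have bP : (b < (size la).+1)%N by apply: part_gt0; have := H b b1; lia.
apply/eqP/cards1P; exists (Ordinal aP, Ordinal bP); apply/setP => -[a' b']; rewrite inE.
apply/IsetP/eqP => [[x' [x1' b1' ba' /(obtainedP x1' b1' ba')[_ _ H']]]|[-> ->]].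
  have HH i : (1 < i)%N ->
      ((i == x) + (i == a') + (i == b') = (i == x') + (i == a) + (i == b))%N.
    move=> i1; move: (H i i1) (H' i i1).
    move: (nat_of_bool (i == x)) (nat_of_bool (i == x')) (nat_of_bool (i == a)).
    move: (nat_of_bool (i == b)) (nat_of_bool (i == a')) (nat_of_bool (i == b')); lia.
  have xx : x = x'.
    have := HH x x1; rewrite eqxx (introF eqP xa) (introF eqP xb) !addn0.
    by case: (x =P x').
  have {}HH i : (1 < i)%N -> ((i == a') + (i == b') = (i == a) + (i == b))%N.
    by move=> /HH; rewrite xx -!addnA => /addnI.
  by have [aa bb] := units_inj b1' ba' b1 ba HH; congr (_, _); apply: val_inj.
exists x; split=> //; apply/obtainedP => //; split=> //=.
  (* Row [x] is removable since nu_(x+1) <= la_(x+1) <= la_x < nu_x. *)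
  have := H x x1; have := H x.+1 (ltnW x1); have := la_anti (ltnW x1); lia.
move=> /eqP ab'; have := ab ab'; have := H a a1; have := H b b1; lia.
Qed.

(** If a, b and x are distinct, rows a and b both grow by one box, so la_a and la_b differ exactly
    when nu_a and nu_b do. *)
Lemma Iset_cases : #|Iset nu la| != 0%N -> exists x a b, [/\ (1 < x)%N, (1 < a)%N, (1 < b)%N,
  a <> b -> x <> a -> x <> b -> part nu a <> part nu b &
  rows la = bar nu - eps 1 - eps x + eps a + eps b].
Proof.
rewrite cards_eq0 => /set0Pn[[a b] /IsetP[x [x1 b1 ba ob]]].
exists x, a, b; split=> //; first exact: leq_trans ba.
  have [_ neq H] := obtainedP x1 b1 ba ob => ab xa xb.
  by have := H a (leq_trans b1 ba); have := H b b1; have := neq (introN eqP ab); lia.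
by case/and5P: ob => _ _ _ _ /andP[_ /eqP].
Qed.

End Bijection.

Theorem corollary4p6 (n : nat) (nu la : intpart)
    (nu_n : sumn nu = n) (nu_neq : parts nu <> [:: n])
    (nu12 : part nu 1 <> part nu 2)
    (la_2n : sumn la = (2 * n)%N)
    (la1 : part la 1 = (n + part nu 1 - 1)%N) :
  let case1 :=
    exists x a b : nat,
      [/\ (2 <= x)%N, (2 <= a)%N & (2 <= b)%N] /\
      [/\ x <> a, x <> b, a <> b -> part nu a <> part nu b
        & rows la = bar nu - eps 1 - eps x + eps a + eps b] in
  let case2 :=
    exists c : nat, (1 < c)%N /\ rows la = bar nu - eps 1 + eps c in
  let coef := hall (plethysm (schur nu) (schur [:: 2%N])) (schur la) in
  [/\ case1 -> coef = #|Iset nu la|%:R /\ #|Iset nu la| = 1%N,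
      case2 -> coef = #|Iset nu la|%:R
    & ~ case1 -> ~ case2 -> coef = 0].
Proof.
move=> case1 case2 coef.
have nu_part : is_intpart nu := valP nu.
have la_part : is_intpart la := valP la.
rewrite -nu_n in la_2n la1.
have nu21 : (part nu 2 <= part nu 1)%N by apply: (intpart_nth_anti nu_part (leqnSn 0)).
have nu1 : (0 < part nu 1)%N by lia.
have [D HD] := schur_expansion_hall (expressible_plethysm nu).
(* [D] makes room for the expansion used by [hall], and 2n for the constituents of the plethysm. *)
pose d := (D + 2 * sumn nu)%N.
have nu_d : (sumn nu <= d)%N by rewrite /d; lia.
have la_d : (sumn la <= d)%N by rewrite la_2n leq_addl.
have [c [cE cH]] := HD d (leq_addr _ _).
have coefE : coef = #|Iset nu la|%:R.
  rewrite /coef (cH _ la_d) -(card_rests nu_d la_d la_2n nu1 la1).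
  have schE N : \sum_a c a *: sch a (vars N) = sch (shape_of d nu) (pairs (vars N)).
    by rewrite -cE (plethysm_sch _ nu_d).
  apply: (coef_next schE); rewrite ?mdeg_shape_of ?rowlen_shape_of ?is_part_shape_of //.
  - by rewrite leq_addl.
  - by move: la1 nu1; rewrite /part /=; lia.
  by move: nu12 nu21; rewrite /part /=; lia.
split=> // [[x [a [b [[x1 a1 b1] [xa xb ab rE]]]]]|n1 n2].
  by split=> //; apply: (card_Iset1 (d := d)) rE.
rewrite coefE; have [->//|] := eqVneq #|Iset nu la| 0%N.
case/(Iset_cases (d := d))=> // x [a [b [x1 a1 b1 ab rE]]].
(* If the removed box is put back, a single added box remains, which is the second case. *)
have [xa|/eqP xa] := eqVneq x a; first by case: n2; exists b; rewrite rE xa subrK.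
have [xb|/eqP xb] := eqVneq x b; first by case: n2; exists a; rewrite rE xb addrAC subrK.
by case: n1; exists x, a, b; split=> //; split=> // ?; apply: ab.
Qed.
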